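(* (Central Plancherel formula) Given $\xi,\xi'\in Z(L\wr G)$, we have $$(\xi,\xi')^Z\;=\;\sum_{i\in[1,k]}\frac1n\left(\frac{x_id_i}{h}\right)^{2}\operatorname{Tr}_{Z(K_i)/K}\Big((\xi)\omega_i^Z\,(\xi')\omega_i^Z\Big).$$
   Context: A finite group $G$ acts (from the right, $y\mapsto y^\sigma$, by field automorphisms, not necessarily faithfully) on a field $L$ with fixed field $K$. Let $N$ be the kernel of this operation, $g=|G|$, $h=[L:K]$, $n=|N|$. Assume that $n$ is invertible in $K$. The twisted group ring $L\wr G$ is the $K$-algebra which as a right $L$-vector space has basis $G$, with multiplication determined by $(\sigma y)(\tau z)=(\sigma\tau)(y^\tau z)$. It is semisimple. Let $X_1,\dots,X_k$ be representatives of the isomorphism classes of simple right $L\wr G$-modules, $K_i=\operatorname{End}_{L\wr G}X_i$ (a skew field), $x_i$ the left $K_i$-dimension of $X_i$, $d_i^2=[K_i:Z(K_i)]$ with $d_i\ge1$. It is known that $x_id_i/h$ is an integer. For $\xi\in Z(L\wr G)$, $(\xi)\omega_i^Z\in Z(K_i)$ is the element by which $\xi$ acts on $X_i$. For $\nu\in N$ let $L_\nu$ be the fixed field of the centralizer $C_G(\nu)$ in $L$. It is known that $Z(L\wr G)$ is spanned over $K$ by the elements $\sum_{\rho\in C_G(\nu)\backslash G}(\nu y)^\rho$ with $\nu\in N$, $y\in L_\nu$, where $(\nu y)^\rho=\nu^\rho y^\rho$ and $\nu^\rho=\rho^{-1}\nu\rho$. The $K$-bilinear form $(-,=)^Z$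 on $Z(L\wr G)$ is defined, for $\nu,\nu'\in N$, $y\in L_\nu$, $y'\in L_{\nu'}$, by $$\Big(\sum_{\rho\in C_G(\nu)\backslash G}(\nu y)^\rho,\ \sum_{\rho'\in C_G(\nu')\backslash G}(\nu'y')^{\rho'}\Big)^{Z}=\begin{cases}[N:C_N(\nu)]\cdot\operatorname{Tr}_{L_\nu/K}(y\,y'^{\tau})&\text{if }\nu=(\nu'^{-1})^\tau\text{ with }\tau\in G,\\0&\text{if }\nu\text{ and }\nu'^{-1}\text{ are not conjugate in }G.\end{cases}$$ *)

(* Defs.v *)
From HB Require Import structures.
From mathcomp Require Import all_boot all_order all_algebra.
From mathcomp Require Import all_fingroup all_field.

Set Implicit Arguments.
Unset Strict Implicit.
Unset Printing Implicit Defensive.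

Import GRing.Theory.
Local Open Scope ring_scope.

(* For E a finite dimensional K-algebra, the trace Tr_{E/K}(z) of the K-linear *)
(* endomorphism v |-> v * z of E.                                              *)
Definition falg_trace (K : fieldType) (E : falgType K) (z : E) : K :=
  \tr (passmx.mxof (vbasis {:E}) (vbasis {:E}) (amulr z)).

(* For V a left D-module with scalar multiplication s: V has a D-basis with m  *)
(* elements, i.e. the coordinate map D^m -> V of some family is bijective.     *)
Definition has_ldim (D : nzRingType) (V : zmodType) (s : D -> V -> V) (m : nat) :=
  exists b : 'I_m -> V,
    bijective (fun c : {ffun 'I_m -> D} => \sum_j s (c j) (b j)).

(* A right action, by field automorphisms, of the group of all elements of gT  *)
(* on L, with fixed field (the image in L of) K. The finiteness of [L : K],    *)
(* here part of the type of L, is automatic by Artin's theorem.                *)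
Record field_action (K : fieldType) (L : fieldExtType K) (gT : finGroupType) :=
  FieldAction {
    fact :> {action gT &-> L};
    factD : forall s y z, fact (y + z) s = fact y s + fact z s;
    fact1 : forall s, fact 1 s = 1;
    factM : forall s y z, fact (y * z) s = fact y s * fact z s;
    fact_fixed : forall y, (forall s, fact y s = y) <-> y \in 1%VS
  }.

Section FieldAction.
Variables (K : fieldType) (L : fieldExtType K) (gT : finGroupType).
Variable a : field_action L gT.
Implicit Types (y z : L) (s t : gT).

Fact fact_is_action : is_action [set: gT] a.
Proof. by case: a => -[]. Qed.

Lemma factgM y s t : a y (s * t)%g = a (a y s) t.
Proof. by case: fact_is_action => _ toM; rewrite toM ?inE. Qed.

Lemma factg1 y : a y 1%g = y.
Proof.
have inj1 : injective (fun z => a z 1%g).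
  by case: fact_is_action => to_inj _ z1 z2; apply: to_inj.
by apply: inj1; rewrite -factgM mulg1.
Qed.

Lemma fact_scale k y s : a (k *: y) s = k *: a y s.
Proof.
have /(fact_fixed a)/(_ s) kA : k%:A \in (1%VS : {vspace L}).
  by rewrite memvZ ?memv_line.
by rewrite -[k *: y]mulr_algl factM kA mulr_algl.
Qed.

Definition fact_fun s y := a y s.

Fact fact_is_linear s : linear (fact_fun s).
Proof. by move=> k y z; rewrite /fact_fun factD fact_scale. Qed.

HB.instance Definition _ s := GRing.isSemilinear.Build K L L _ (fact_fun s)
  (GRing.semilinear_linear (fact_is_linear s)).

Definition galop s : 'End(L) := linfun (fact_fun s).

Lemma galopE s y : galop s y = a y s.
Proof. by rewrite lfunE. Qed.

Lemma fact0 s : a 0 s = 0.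
Proof. exact: (linear0 (fact_fun s)). Qed.

Lemma fact_sum (I : finType) (F : I -> L) s : a (\sum_i F i) s = \sum_i a (F i) s.
Proof. exact: (linear_sum (fact_fun s)). Qed.

Definition act_kernel : {set gT} := [set s | galop s == \1%VF].

Lemma act_kernelP s : reflect (forall y, a y s = y) (s \in act_kernel).
Proof.
rewrite inE; apply: (iffP eqP) => [e y | e]; first by rewrite -galopE e lfunE.
by apply/lfunP=> y; rewrite galopE e lfunE.
Qed.

Fact act_kernel_group_set : group_set act_kernel.
Proof.
apply/group_setP; split=> [|s t /act_kernelP Ns /act_kernelP Nt].
  by apply/act_kernelP=> y; rewrite factg1.
by apply/act_kernelP=> y; rewrite factgM Ns Nt.
Qed.
Canonical act_kernel_group := Group act_kernel_group_set.

Definition cent_fixed (v : gT) : {vspace L} :=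
  (\bigcap_(s in 'C[v]%g) fixedSpace (galop s))%VS.

Lemma cent_fixedP v y :
  reflect (forall s, s \in 'C[v]%g -> a y s = y) (y \in cent_fixed v).
Proof.
by apply: (iffP subv_bigcapP) => h s /h; rewrite -galopE => /fixedSpaceP.
Qed.

Fact cent_fixed_is_aspace v : is_aspace (cent_fixed v).
Proof.
rewrite /is_aspace has_algid1; last by apply/cent_fixedP=> s _; rewrite fact1.
apply/prodvP=> y z /cent_fixedP fy /cent_fixedP fz.
by apply/cent_fixedP=> s Cs; rewrite factM fy ?fz.
Qed.
Canonical cent_fixed_aspace v : {subfield L} := ASpace (cent_fixed_is_aspace v).

End FieldAction.

(* The twisted group ring: f : twisted_ring a stands for \sum_s s (f s), the   *)
(* coefficients in L being written on the right of the group elements.         *)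
Definition twisted_ring (K : fieldType) (L : fieldExtType K)
  (gT : finGroupType) (a : field_action L gT) := {ffun gT -> L}.

Section TwistedRing.
Variables (K : fieldType) (L : fieldExtType K) (gT : finGroupType).
Variable a : field_action L gT.
Local Notation A := (twisted_ring a).
Implicit Types f g h : A.

HB.instance Definition _ := Vector.on A.

(* the element s y *)
Definition tw (s : gT) (y : L) : A := [ffun r => if r == s then y else 0].

(* (\sum_s s (f s)) (\sum_t t (g t)) = \sum_(s, t) (s t) ((f s)^t (g t)) *)
Definition tw_mul f g : A :=
  [ffun r => \sum_t a (f (r * t^-1)%g) t * g t].

Fact tw_mulA : associative tw_mul.
Proof.
move=> f g h; apply/ffunP=> r; rewrite !ffunE.
under eq_bigr => t _ do rewrite ffunE mulr_sumr.
under [RHS]eq_bigr => t _ do rewrite ffunE fact_sum mulr_suml.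
rewrite [RHS]exchange_big [LHS]exchange_big /=.
rewrite [RHS]exchange_big /=; apply: eq_bigr => t _.
rewrite (reindex_inj (mulIg t)) /=; apply: eq_bigr => s _.
by rewrite mulgK factM -factgM mulrA invMg !mulgA.
Qed.

Fact tw_mul1g : left_id (tw 1 1) tw_mul.
Proof.
move=> f; apply/ffunP=> r; rewrite ffunE (bigD1 r) //= big1 => [|t ne_tr].
  by rewrite ffunE mulgV eqxx fact1 mul1r addr0.
rewrite ffunE -eq_mulgV1 eq_sym (negPf ne_tr).
by rewrite fact0 mul0r.
Qed.

Fact tw_mulg1 : right_id (tw 1 1) tw_mul.
Proof.
move=> f; apply/ffunP=> r; rewrite ffunE (bigD1 1%g) //= big1 => [|t ne_t1].
  by rewrite ffunE eqxx invg1 mulg1 factg1 mulr1 addr0.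
by rewrite ffunE (negPf ne_t1) mulr0.
Qed.

Fact tw_mulDl : left_distributive tw_mul +%R.
Proof.
move=> f g h; apply/ffunP=> r; rewrite !ffunE -big_split /=.
by apply: eq_bigr => t _; rewrite ffunE factD mulrDl.
Qed.

Fact tw_mulDr : right_distributive tw_mul +%R.
Proof.
move=> f g h; apply/ffunP=> r; rewrite !ffunE -big_split /=.
by apply: eq_bigr => t _; rewrite ffunE mulrDr.
Qed.

Fact tw_one_neq0 : tw 1 1 != 0.
Proof. by apply/eqP=> /ffunP/(_ 1%g)/eqP; rewrite !ffunE eqxx oner_eq0. Qed.

HB.instance Definition _ := GRing.Zmodule_isNzRing.Build A
  tw_mulA tw_mul1g tw_mulg1 tw_mulDl tw_mulDr tw_one_neq0.

Fact tw_scaleAl (k : K) f g : k *: (f * g) = (k *: f) * g.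
Proof.
apply/ffunP=> r; rewrite !ffunE scaler_sumr.
by apply: eq_bigr => t _; rewrite ffunE fact_scale scalerAl.
Qed.
HB.instance Definition _ := GRing.Lmodule_isLalgebra.Build K A tw_scaleAl.

Fact tw_scaleAr (k : K) f g : k *: (f * g) = f * (k *: g).
Proof.
apply/ffunP=> r; rewrite !ffunE scaler_sumr.
by apply: eq_bigr => t _; rewrite ffunE scalerAr.
Qed.
HB.instance Definition _ := GRing.Lalgebra_isAlgebra.Build K A tw_scaleAr.
HB.instance Definition _ := Algebra_isFalgebra.Build K A.

Lemma tw_mulE s y t z : tw s y * tw t z = tw (s * t)%g (a y t * z).
Proof.
apply/ffunP=> r; rewrite !ffunE (bigD1 t) //= big1 => [|u ne_ut].
  rewrite !ffunE eqxx addr0 -(can_eq (mulgK t) _ s) mulgKV.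
  by case: eqP => // _; rewrite fact0 mul0r.
by rewrite !ffunE (negPf ne_ut) mulr0.
Qed.

Lemma tw_sum f : f = \sum_s tw s (f s).
Proof.
apply/ffunP=> r; rewrite sum_ffunE (bigD1 r) //= big1 => [|s ne_sr].
  by rewrite ffunE eqxx addr0.
by rewrite ffunE eq_sym (negPf ne_sr).
Qed.

End TwistedRing.

Notation central A := (subvs_of 'Z({:A})%AS).

Section CentralForm.
Variables (K : fieldType) (L : fieldExtType K) (gT : finGroupType).
Variable a : field_action L gT.
Local Notation A := (twisted_ring a).
Local Notation N := (act_kernel a).

(* \sum_(r in C_G(v) \ G) (v y)^r; when y is fixed by C_G(v) the summand only  *)
(* depends on the coset of r.                                                  *)
Definition class_sum (v : gT) (y : L) : A :=
  \sum_(R in rcosets 'C[v] [set: gT]) tw a (v ^ repr R)%g (a y (repr R)).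

Lemma class_sum_term v y R r : y \in cent_fixed a v ->
  R \in rcosets 'C[v] [set: gT] -> r \in R ->
  tw a (v ^ repr R)%g (a y (repr R)) = tw a (v ^ r)%g (a y r).
Proof.
move=> /cent_fixedP fy /rcosetsP[t _ ->] /rcosetP[c Cc ->].
have /rcosetP[d Cd ->] : repr ('C[v] :* t)%g \in ('C[v] :* t)%g.
  exact: mem_repr_rcoset.
have vC e : e \in 'C[v]%g -> (v ^ e)%g = v.
  by move/cent1P=> ve; rewrite conjgE -ve mulKg.
by rewrite !conjgM !factgM (vC c) ?(vC d) ?(fy c) ?(fy d).
Qed.

Lemma class_sum_central v y : v \in N -> y \in cent_fixed a v ->
  class_sum v y \in 'Z({:A})%AS.
Proof.
move=> Nv fy; rewrite memv_cap memvf; apply/centvP=> f _.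
rewrite [f]tw_sum mulr_sumr mulr_suml; apply: eq_bigr => s _.
move: (f s) => z; rewrite mulr_sumr mulr_suml [RHS](reindex_inj (can_inj (rcosetK s))) /=.
have inR R : (R :* s \in rcosets 'C[v] [set: gT])%g = (R \in rcosets 'C[v] [set: gT]).
  apply/rcosetsP/rcosetsP=> [[t _ e] | [t _ ->]]; last first.
    by exists (t * s)%g; rewrite ?inE ?rcosetM.
  by exists (t * s^-1)%g; rewrite ?inE // -(rcosetK s R) e rcosetM.
apply: eq_big => [R | R RC]; first by rewrite inR.
have Rr : repr R \in R by case/rcosetsP: RC => t _ ->; apply: mem_repr_rcoset.
rewrite (@class_sum_term _ _ (R :* s)%g (repr R * s)%g fy) ?inR //; last first.
  by rewrite mem_rcoset mulgK.
have az t : a z (v ^ t)%g = z.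
  by rewrite conjgE !factgM (act_kernelP _ _ Nv) -factgM mulVg factg1.
by rewrite !tw_mulE az mulrC conjgM -conjgC factgM.
Qed.

(* B is the form (-, =)^Z: the values below determine it, since the class sums *)
(* span the centre over K. For y, y' fixed by C_G(v), C_G(v') respectively and *)
(* v = (v'^-1)^t, the product y * y'^t lies in the field L_v, so that vsproj   *)
(* merely regards it as an element of L_v.                                     *)
Definition is_central_form (B : {biscalar (central A)}) : Prop :=
  forall (v v' : gT) (y y' : L) (Nv : v \in N) (Nv' : v' \in N)
    (fy : y \in cent_fixed a v) (fy' : y' \in cent_fixed a v'),
  let b := B (Subvs (class_sum_central Nv fy))
             (Subvs (class_sum_central Nv' fy')) in
  (forall t, v = (v'^-1 ^ t)%g ->
     b = #|N : 'C_N[v]|%g%:R *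
         falg_trace (vsproj (cent_fixed_aspace a v) (y * a y' t)))
  /\ ((forall t, v <> (v'^-1 ^ t)%g) -> b = 0).

End CentralForm.

(* Right A-modules of finite dimension over K, the K-linear structure being    *)
(* the one induced by K -> A. All simple right A-modules are of this kind.     *)
Record rmodule (K : fieldType) (A : falgType K) := RModule {
  rmod_sort :> vectType K;
  ract : rmod_sort -> A -> rmod_sort;
  ractDl : forall u v x, ract (u + v) x = ract u x + ract v x;
  ractDr : forall u x y, ract u (x + y) = ract u x + ract u y;
  ract1 : forall u, ract u 1 = u;
  ractM : forall u x y, ract u (x * y) = ract (ract u x) y;
  ract_scalar : forall u k, ract u k%:A = k *: u
}.

Section RModule.
Variables (K : fieldType) (A : falgType K).

Definition submodule (X : rmodule A) (U : {vspace X}) : Prop :=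
  forall u x, u \in U -> ract u x \in U.

Definition simple_module (X : rmodule A) : Prop :=
  {:X}%VS <> 0%VS /\
  (forall U : {vspace X}, submodule U -> U = 0%VS \/ U = {:X}%VS).

Definition module_iso (X Y : rmodule A) : Prop :=
  exists f : 'Hom(X, Y),
    bijective f /\ (forall u x, f (ract u x) = ract (f u) x).

Record simple_rmodule := SimpleRModule {
  srmod_val :> rmodule A;
  srmod_simple : simple_module srmod_val
}.

Section Endo.
Variable X : rmodule A.

Lemma ract_scale u k x : ract (k *: u : X) x = k *: ract u x.
Proof.
by rewrite -!ract_scalar -!ractM mulr_algl mulr_algr.
Qed.

Lemma ract_scaler (u : X) k x : ract u (k *: x) = k *: ract u x.
Proof. by rewrite -mulr_algr ractM ract_scalar. Qed.

Definition rmul (x : A) (u : X) := ract u x.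
Fact rmul_is_linear x : linear (rmul x).
Proof. by move=> k u v; rewrite /rmul ractDl ract_scale. Qed.
HB.instance Definition _ x := GRing.isSemilinear.Build K X X _ (rmul x)
  (GRing.semilinear_linear (rmul_is_linear x)).

Definition ractop (x : A) : 'End(X) := linfun (rmul x).

Lemma ractopE x u : ractop x u = ract u x.
Proof. by rewrite lfunE. Qed.

Fact ractop_is_linear : linear ractop.
Proof.
move=> k x y; apply/lfunP=> u.
by rewrite add_lfunE scale_lfunE !ractopE ractDr ract_scaler.
Qed.
HB.instance Definition _ := GRing.isSemilinear.Build K A 'End(X) _ ractop
  (GRing.semilinear_linear ractop_is_linear).

Definition ract_comm (x : A) (f : 'End(X)) : 'End(X) :=
  ((f \o ractop x) - (ractop x \o f))%VF.
Fact ract_comm_is_linear x : linear (ract_comm x).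
Proof.
move=> k f g; apply/lfunP=> u; rewrite /ract_comm.
rewrite !(add_lfunE, opp_lfunE, comp_lfunE, scale_lfunE) (linearP (ractop x)) /=.
by rewrite scalerBr opprD addrACA.
Qed.
HB.instance Definition _ x := GRing.isSemilinear.Build K 'End(X) 'End(X) _
  (ract_comm x) (GRing.semilinear_linear (ract_comm_is_linear x)).

(* the space of A-linear endomorphisms; see endo_spaceP *)
Definition endo_space : {vspace 'End(X)} :=
  (\bigcap_(i < \dim {:A}) lker (linfun (ract_comm (vbasis {:A})`_i)))%VS.

Lemma endo_spaceP (f : 'End(X)) :
  reflect (forall u x, f (ract u x) = ract (f u) x) (f \in endo_space).
Proof.
apply: (iffP subv_bigcapP) => [h u x | h i _]; last first.
  rewrite -memvE memv_ker lfunE /=; apply/eqP/lfunP=> u.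
  by rewrite /ract_comm !(add_lfunE, opp_lfunE, comp_lfunE) !ractopE h subrr zero_lfunE.
rewrite (coord_vbasis (memvf x)) -!ractopE !linear_sum !sum_lfunE linear_sum.
apply: eq_bigr => i _; have := h i isT.
rewrite -memvE memv_ker lfunE /= => /eqP/lfunP/(_ u)/eqP.
rewrite /ract_comm !(add_lfunE, opp_lfunE, comp_lfunE) zero_lfunE subr_eq0 => /eqP e.
by rewrite !linearZ /= !scale_lfunE linearZ /= e.
Qed.

End Endo.

(* the skew field End_A(X) of a simple X, acting on X from the left *)
Definition endo (X : simple_rmodule) := subvs_of (endo_space X).

Section EndoRing.
Variable X : simple_rmodule.
Implicit Types f g h : endo X.

HB.instance Definition _ := Vector.on (endo X).

Definition endo_app f (u : X) : X := vsval f u.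

Lemma endo_appA f u x : endo_app f (ract u x) = ract (endo_app f u) x.
Proof. exact: (endo_spaceP _ (subvsP f)). Qed.

Fact endo_one_subproof : \1%VF \in endo_space X.
Proof. by apply/endo_spaceP=> u x; rewrite !lfunE. Qed.
Definition endo_one : endo X := Subvs endo_one_subproof.

Fact endo_mul_subproof f g : (vsval f \o vsval g)%VF \in endo_space X.
Proof.
by apply/endo_spaceP=> u x; rewrite !lfunE /= -!/(endo_app _ _) !endo_appA.
Qed.
Definition endo_mul f g : endo X := Subvs (endo_mul_subproof f g).

Fact endo_mulA : associative endo_mul.
Proof. by move=> f g h; apply/val_inj; rewrite /= comp_lfunA. Qed.
Fact endo_mul1f : left_id endo_one endo_mul.
Proof. by move=> f; apply/val_inj; rewrite /= comp_lfun1l. Qed.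
Fact endo_mulf1 : right_id endo_one endo_mul.
Proof. by move=> f; apply/val_inj; rewrite /= comp_lfun1r. Qed.
Fact endo_mulDl : left_distributive endo_mul +%R.
Proof. by move=> f g h; apply/val_inj; rewrite /= comp_lfunDl. Qed.
Fact endo_mulDr : right_distributive endo_mul +%R.
Proof. by move=> f g h; apply/val_inj; rewrite /= comp_lfunDr. Qed.
Fact endo_one_neq0 : endo_one != 0.
Proof.
apply/eqP=> /(congr1 vsval)/lfunP e; case: (srmod_simple X) => nz _; apply: nz.
apply/eqP; rewrite -subv0; apply/subvP=> u _.
by have := e u; rewrite !lfunE /= => ->; rewrite mem0v.
Qed.

HB.instance Definition _ := GRing.Zmodule_isNzRing.Build (endo X)
  endo_mulA endo_mul1f endo_mulf1 endo_mulDl endo_mulDr endo_one_neq0.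

Fact endo_scaleAl (k : K) f g : k *: (f * g) = (k *: f) * g.
Proof. by apply/val_inj; rewrite /= comp_lfunZl. Qed.
HB.instance Definition _ := GRing.Lmodule_isLalgebra.Build K (endo X) endo_scaleAl.

Fact endo_scaleAr (k : K) f g : k *: (f * g) = f * (k *: g).
Proof. by apply/val_inj; rewrite /= comp_lfunZr. Qed.
HB.instance Definition _ := GRing.Lalgebra_isAlgebra.Build K (endo X) endo_scaleAr.
HB.instance Definition _ := Algebra_isFalgebra.Build K (endo X).

Lemma endo_mulE f g u : endo_app (f * g) u = endo_app f (endo_app g u).
Proof. by rewrite /endo_app /= lfunE. Qed.

(* the element by which a central element of A acts on X *)
Fact omega_endo (xi : central A) : ractop X (vsval xi) \in endo_space X.
Proof.
have /memv_capP[_ /centvP xiC] := subvsP xi.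
by apply/endo_spaceP=> u x; rewrite !ractopE -!ractM xiC ?memvf.
Qed.

Fact omega_central (xi : central A) :
  (Subvs (omega_endo xi) : endo X) \in 'Z({:endo X})%AS.
Proof.
rewrite memv_cap memvf; apply/centvP=> f _; apply/val_inj/lfunP=> u /=.
by rewrite !lfunE /= !ractopE -/(endo_app _ _) -endo_appA.
Qed.

Definition omega (xi : central A) : central (endo X) := Subvs (omega_central xi).

Lemma omegaE xi u : endo_app (vsval (omega xi)) u = ract u (vsval xi).
Proof. exact: ractopE. Qed.

End EndoRing.
End RModule.

(* Main.v *)
(* Write A for the twisted group ring, F_i for the centre of K_i, h = [L : K],  *)
(* n = |N|. The form is (xi, xi')^Z = the coefficient at 1 of xi xi'. Since K   *)
(* may have characteristic dividing h, that coefficient is not read off the     *)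
(* regular trace of A but off the trace over K of v |-> y z v on the subalgebra *)
(* L[N] of A, where y in L has sum_s y^s = n: this trace is n times the         *)
(* coefficient of z at 1. By density and Maschke's theorem L[N] splits into the *)
(* F_i-spaces U_i = e_i L[N], where e_i is the central idempotent of A acting   *)
(* as 1 on X_i and as 0 on the other X_j; conjugation by s is an F_i-linear     *)
(* automorphism of U_i carrying y to y^s.                                       *)
(* Hence the characteristic polynomial R_y of y on U_i satisfies                *)
(* R_y^|G| = (prod_s (X - y^s))^c with c = dim_{F_i} U_i. A generator of the    *)
(* separable extension L/K forces h | c, and then                               *)
(* R_y^n = (prod_s (X - y^s))^(c/h), so that y has trace c/h on U_i. Finally    *)
(* h c = (x_i d_i)^2 by counting dimensions in e_i A, so h divides x_i d_i and  *)
(* c/h = (x_i d_i / h)^2.                                                       *)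

From HB Require Import structures.
Require Import Defs.
From mathcomp Require Import all_boot all_order all_algebra.
From mathcomp Require Import all_fingroup all_field.
From Stdlib Require Import Classical.

Set Implicit Arguments.
Unset Strict Implicit.
Unset Printing Implicit Defensive.

Import GRing.Theory.
Local Open Scope ring_scope.
(* The unqualified name now denotes the restriction of a group action. *)
Local Notation ract := Defs.ract.

(** * Traces of endomorphisms and vector spaces over an extension field *)

(** One trace over K is computed in two ways. By [central_form_coef] the form is the coefficient at
    1 of the product of its arguments. Put z = xi xi', choose y in L whose conjugates under G add up
    to n, and let Theta be the K-linear map on A that discards the coefficients outside N and then
    multiplies by y z from the left.

    The diagonal block of Theta at s L, for s in N, is multiplication by z(1) y on L, and n Tr(y) =
    n by [galois_trace]; so Theta has trace n z(1) ([trace_kernel_restriction]).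

    Theta also splits along the central idempotents e_i ([trace_kernel_components]). These exist by
    [density], and they add up to 1 because only 0 kills all simple modules ([maschke],
    [simple_modules_faithful]). On U_i = e_i L[N] the element z is the scalar omega_i(z) of F_i, so
    the i-th part has trace Tr_{F_i/K}(omega_i(z) t_i), where t_i is the F_i-trace of y on U_i
    ([lftrace_scalar_operator]).

    To find t_i, note that conjugation by group elements makes y similar to each y^s, which
    determines a power of the characteristic polynomial of y. [semilinear_rank] and
    [semilinear_trace] take roots of polynomials instead of dividing by h, which may be zero in K,
    and give t_i = c/h with c = dim_{F_i} U_i. Comparing [component_dim] with [component_coset_dim]
    gives h c = (x_i d_i)^2. The same semilinear argument over L_v yields [trace_tower], on which
    [central_form_coef] rests. *)

Section EndomorphismTrace.
Variable K : fieldType.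
Implicit Types U V W : vectType K.

Definition lftrace V (f : 'End(V)) : K :=
  \tr (passmx.mxof (vbasis {:V}) (vbasis {:V}) f).

Fact lftrace_is_linear V : scalar (@lftrace V).
Proof.
by move=> k f g; rewrite /lftrace passmx.mxof_linear mxtraceD mxtraceZ.
Qed.
HB.instance Definition _ V :=
  GRing.isSemilinear.Build K 'End(V) K *%R (@lftrace V)
    (GRing.semilinear_linear (@lftrace_is_linear V)).

(** Cyclicity between different spaces moves a trace on a large space to F or L; below it takes the
    place of bases adapted to a decomposition. *)
Lemma lftrace_comp V W (f : 'Hom(V, W)) (g : 'Hom(W, V)) :
  lftrace (g \o f)%VF = lftrace (f \o g)%VF.
Proof.
have mxofM V1 V2 V3 (p : 'Hom(V1, V2)) (q : 'Hom(V2, V3)) :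
    passmx.mxof (vbasis {:V1}) (vbasis {:V3}) (q \o p)%VF =
    passmx.mxof (vbasis {:V1}) (vbasis {:V2}) p
      *m passmx.mxof (vbasis {:V2}) (vbasis {:V3}) q.
  apply/row_matrixP => i; rewrite !rowE mulmxA !passmx.mul_mxof.
  by rewrite passmx.rVofK ?vbasisP // comp_lfunE.
by rewrite /lftrace !mxofM mxtrace_mulC.
Qed.

Lemma falg_traceE (E : falgType K) (z : E) : falg_trace z = lftrace (amulr z).
Proof. by []. Qed.

Lemma falg_trace_is_linear (E : falgType K) : scalar (@falg_trace K E).
Proof. by move=> k x y; rewrite !falg_traceE !linearP. Qed.
HB.instance Definition _ (E : falgType K) :=
  GRing.isSemilinear.Build K E K *%R (@falg_trace K E)
    (GRing.semilinear_linear (@falg_trace_is_linear E)).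

Lemma falg_trace_scalar (E : falgType K) (k : K) :
  falg_trace (k%:A : E) = (\dim {:E})%:R * k.
Proof.
rewrite linearZ /= falg_traceE rmorph1 mulrC; congr (_ * _).
rewrite /lftrace -[1]/(\1%VF : 'End(E)) passmx.mxof1 ?mxtrace1 //.
exact: basis_free (vbasisP _).
Qed.

Lemma dim_bij V W (f : {linear V -> W}) : bijective f -> \dim {:V} = \dim {:W}.
Proof.
case=> g fK gK; rewrite -(limg_dim_eq (f := linfun f)); last first.
  apply/eqP; rewrite -subv0; apply/subvP => v.
  rewrite memv_cap memv_ker lfunE /= => /andP[_ /eqP fv0].
  by rewrite memv0 -[v]fK fv0 -(linear0 f) fK.
congr (\dim _); apply/eqP; rewrite eqEsubv subvf /=; apply/subvP => w _.
by rewrite -[w]gK -[f _]lfunE memv_img ?memvf.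
Qed.

Lemma dim_bij_ffun V W (J : finType) (f : {linear {ffun J -> V} -> W}) :
  bijective f -> \dim {:W} = (#|J| * \dim {:V})%N.
Proof. by move=> /dim_bij <-; rewrite !dimvf. Qed.

Lemma dim_subvs V (U : {vspace V}) : \dim {:subvs_of U} = \dim U.
Proof. by rewrite dimvf. Qed.

End EndomorphismTrace.

(* A field extension F of K acting on W through K-linear maps s f; only on     *)
(* subspaces U where s 1 is the identity is this a vector space structure.     *)
Section Scalars.
Variables (K : fieldType) (F : fieldExtType K) (W : vectType K).
Variable s : F -> 'End(W).
Hypothesis s_linear : linear s.
Hypothesis sM : forall f g w, s (f * g) w = s f (s g w).

Definition unital_stable (U : {vspace W}) :=
  forall u, u \in U -> s 1 u = u /\ forall f, s f u \in U.

Let sL := GRing.isSemilinear.Build K F 'End(W) _ s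
  (GRing.semilinear_linear s_linear).
HB.instance Definition _ := sL.

Definition orbit_map (w : W) : 'Hom(F, W) := linfun (fun f => s f w).

Lemma orbit_mapE w f : orbit_map w f = s f w.
Proof.
have lin : linear (fun f => s f w).
  by move=> k f1 f2; rewrite linearP add_lfunE scale_lfunE.
pose H := GRing.isSemilinear.Build K F W _ (fun f => s f w)
  (GRing.semilinear_linear lin).
pose h : {linear F -> W} := HB.pack (fun f => s f w) H.
by rewrite /orbit_map -[fun f => s f w]/(h : F -> W) lfunE.
Qed.

(** A stable U1 disjoint from U0 can be enlarged by the line F u of any u in U outside U0 + U1; the
    induction is on a bound for the codimension of U1. *)
Lemma unital_stable_complement (U U0 : {vspace W}) :
  unital_stable U -> unital_stable U0 -> (U0 <= U)%VS ->
  exists U1, [/\ unital_stable U1, (U0 :&: U1 = 0)%VS & (U0 + U1 = U)%VS].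
Proof.
move=> stU stU0 sU0U.
pose good (U1 : {vspace W}) :=
  [/\ unital_stable U1, (U0 :&: U1 = 0)%VS & (U1 <= U)%VS].
suff: forall m U1, good U1 -> (\dim U - \dim U1 <= m)%N ->
    exists U1, good U1 /\ (U0 + U1 = U)%VS.
  case/(_ _ 0%VS _ (leqnn _)).
    split; rewrite ?capv0 ?sub0v // => u; rewrite memv0 => /eqP->.
    by split=> [|f]; rewrite linear0 ?mem0v.
  by move=> U1 [[]]; exists U1.
elim=> [|m IH] U1 [st1 cap1 sub1].
  rewrite leqn0 subn_eq0 => le; exists U1; split=> //.
  have eU : U1 = U by apply/eqP; rewrite eqEdim sub1.
  by apply/eqP; rewrite eqEsubv subv_add sU0U sub1 -{1}eU addvSr.
have [sub|/subvPn[u Uu nu]] := boolP (U <= U0 + U1)%VS.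
  move=> _; exists U1; split=> //.
  by apply/eqP; rewrite eqEsubv sub subv_add sU0U sub1.
move=> led; apply: (IH (U1 + limg (orbit_map u))%VS).
  split; last by rewrite subv_add sub1 /=; apply/subvP => _ /memv_imgP[f _ ->];
    rewrite orbit_mapE; case: (stU _ Uu).
    move=> _ /memv_addP[v Uv [_ /memv_imgP[f _ ->] ->]]; rewrite orbit_mapE.
    have [s1v sv] := st1 _ Uv.
    split; first by rewrite linearD /= s1v -sM mul1r.
    move=> g; rewrite linearD /= memv_add // -sM -orbit_mapE.
    by rewrite memv_img ?memvf.
  apply/eqP; rewrite -subv0; apply/subvP => v /memv_capP[U0v].
  case/memv_addP => w Uw [_ /memv_imgP[f _ ->] ev]; rewrite orbit_mapE in ev.
  (* A nonzero f is invertible, and then u = f^-1 (f u) would lie in U0 + U1. *)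
  have [f0|fn0] := eqVneq f 0.
    have ew: v = w by rewrite ev f0 linear0 zero_lfunE addr0.
    by rewrite -cap1 memv_cap U0v ew Uw.
  case/negP: nu.
  have [s1u _] := stU _ Uu.
  have: s f u \in (U0 + U1)%VS.
    by rewrite -(addKr w (s f u)) -ev addrC memv_add // memvN.
  case/memv_addP => p Up [q Uq epq].
  rewrite -s1u -(mulVf fn0) sM epq linearD /= memv_add //.
    by case: (stU0 _ Up).
  by case: (st1 _ Uq).
have lt: (\dim U1 < \dim (U1 + limg (orbit_map u)))%N.
  rewrite ltn_neqAle dimvS ?addvSl // andbT; apply: contra nu => /eqP e.
  have /eqP -> : U1 == (U1 + limg (orbit_map u))%VS.
    by rewrite eqEdim addvSl e leqnn.
  have [s1u _] := stU _ Uu.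
  apply: (subvP (addvSr U0 _)); apply: (subvP (addvSr U1 _)).
  by rewrite -{1}s1u -orbit_mapE memv_img ?memvf.
rewrite leq_subLR in led; rewrite leq_subLR; apply: leq_trans led _.
by rewrite addnS -addSn leq_add2r.
Qed.

(** Splitting off one line F u at a time yields an F-basis. The coordinates [p] are K-linear maps on
    all of W, so that they compose with endomorphisms of W; only on U are they F-linear. *)
Lemma scalars_basis (U : {vspace W}) : unital_stable U ->
  exists (c : nat) (w : 'I_c -> W) (p : 'I_c -> 'Hom(W, F)),
  [/\ forall j, w j \in U,
      forall u, u \in U -> u = \sum_j s (p j u) (w j),
      forall j k f, p j (s f (w k)) = f *+ (j == k)
    & forall j u f, u \in U -> p j (s f u) = f * p j u].
Proof.
have [m] := ubnP (\dim U); elim: m U => // m IH U.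
rewrite ltnS => ledU stU.
have [U0|Un0] := eqVneq U 0%VS.
  exists 0%N, (fun=> 0), (fun=> 0); split=> [[]//|u||] //; last by case.
    by rewrite U0 memv0 big_ord0 => /eqP.
  by case.
have nzu := Un0; rewrite -vpick0 in nzu; have Uu := memv_pick U.
move: (vpick U) nzu Uu => u nzu Uu.
have [s1u stu] := stU u Uu.
have injs f : s f u = 0 -> f = 0.
  move=> sfu; apply/eqP; apply: contraT => nzf; case/eqP: nzu.
  by rewrite -s1u -(mulVf nzf) sM sfu linear0.
have ker0 : lker (orbit_map u) == 0%VS.
  rewrite -subv0; apply/subvP => f; rewrite memv_ker orbit_mapE memv0.
  by move/eqP/injs->.
have st0 : unital_stable (limg (orbit_map u)).
  move=> _ /memv_imgP[f _ ->]; rewrite orbit_mapE -sM mul1r; split=> // g.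
  by rewrite -sM -orbit_mapE memv_img ?memvf.
have sub0 : (limg (orbit_map u) <= U)%VS.
  by apply/subvP => _ /memv_imgP[f _ ->]; rewrite orbit_mapE.
have [U1 [st1 cap1 sum1]] := unital_stable_complement stU st0 sub0.
have sub1 : (U1 <= U)%VS by rewrite -sum1 addvSr.
have uL : u \in limg (orbit_map u).
  by rewrite -{1}s1u -orbit_mapE memv_img ?memvf.
have [|c [w [p [wU eU pw psu]]]] := IH U1 _ st1.
  apply: leq_trans _ ledU; rewrite -sum1 dimv_disjoint_sum // -[X in (X < _)%N]add0n.
  rewrite ltn_add2r lt0n dimv_eq0; apply: contraNneq nzu => e.
  by rewrite -memv0 -e.
pose q0 := daddv_pi (limg (orbit_map u)) U1.
pose q1 := daddv_pi U1 (limg (orbit_map u)).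
have cap1' : (U1 :&: limg (orbit_map u) = 0)%VS by rewrite capvC.
have q0L v : q0 v \in limg (orbit_map u) by rewrite memv_pi.
have q1U v : q1 v \in U1 by rewrite memv_pi.
have q01 v : v \in U -> q0 v + q1 v = v.
  by move=> Uv; apply: daddv_pi_add; rewrite // sum1.
have qu v v1 : v \in limg (orbit_map u) -> v1 \in U1 ->
    q0 (v + v1) = v /\ q1 (v + v1) = v1.
  move=> Lv Uv1; rewrite !linearD /= (daddv_pi_id cap1 Lv) (daddv_pi_id cap1' Uv1).
  have -> : q0 v1 = 0.
    apply: (addIr (q1 v1)); rewrite q01 ?(subvP sub1) // add0r.
    by rewrite (daddv_pi_id cap1').
  have -> : q1 v = 0.
    apply: (addrI (q0 v)); rewrite q01 ?(subvP sub0) // addr0.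
    by rewrite (daddv_pi_id cap1).
  by rewrite addr0 add0r.
have qs v f : v \in U -> q0 (s f v) = s f (q0 v) /\ q1 (s f v) = s f (q1 v).
  move=> Uv; rewrite -{1 3}(q01 v Uv) linearD /=.
  by apply: qu; [case: (st0 _ (q0L v)) | case: (st1 _ (q1U v))].
pose iu := ((orbit_map u)^-1)%VF.
have iuK f : iu (s f u) = f by rewrite -orbit_mapE lker0_lfunK.
have iuV v : v \in limg (orbit_map u) -> s (iu v) u = v.
  by case/memv_imgP => f _ ->; rewrite orbit_mapE iuK.
(* Index 0 belongs to u, whose coordinate is read off with the inverse [iu] of f |-> s f u; the
   other indices come from the basis of U1. *)
exists c.+1, (fun j => oapp w u (unlift ord0 j)),
  (fun j => oapp (fun j' => p j' \o q1)%VF (iu \o q0)%VF (unlift ord0 j)).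
split.
- by move=> j; case: unliftP => [j'|] _ //=; apply: (subvP sub1).
- move=> v Uv; rewrite big_ord_recl unlift_none /= comp_lfunE iuV //.
  rewrite -{1}(q01 _ Uv); congr (_ + _); rewrite {1}(eU _ (q1U v)).
  by apply: eq_bigr => j _; rewrite liftK /= comp_lfunE.
- move=> j k f; have [w0 _] := qu _ _ uL (mem0v _).
  case: (unliftP ord0 k) => [k'|] -> /=; rewrite ?liftK ?unlift_none /=.
    have [e0 e1] := qu 0 (s f (w k')) (mem0v _) (proj2 (st1 _ (wU k')) f).
    rewrite add0r in e0 e1.
    case: (unliftP ord0 j) => [j'|] -> /=; rewrite ?liftK ?unlift_none /=.
      by rewrite comp_lfunE e1 pw (inj_eq lift_inj).
    by rewrite comp_lfunE e0 linear0.
  have [e0 e1] := qu (s f u) 0 (proj2 (st0 _ uL) f) (mem0v _).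
  rewrite addr0 in e0 e1.
  case: (unliftP ord0 j) => [j'|] -> /=; rewrite ?liftK ?unlift_none /=.
    by rewrite comp_lfunE e1 linear0.
  by rewrite comp_lfunE e0 iuK.
- move=> j v f Uv; have [e0 e1] := qs v f Uv.
  case: (unliftP ord0 j) => [j'|] _ /=.
    by rewrite !comp_lfunE e1 psu.
  rewrite !comp_lfunE e0; case/memv_imgP: (q0L v) => g _ ->.
  by rewrite orbit_mapE -sM !iuK.
Qed.


(** * F-linear operators on U: matrices over F and traces over K *)

Section ScalarOperators.
Variables (U : {vspace W}) (c : nat) (w : 'I_c -> W) (p : 'I_c -> 'Hom(W, F)).
Hypotheses (stU : unital_stable U) (wU : forall j, w j \in U).
Hypothesis eU : forall u, u \in U -> u = \sum_j s (p j u) (w j).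
Hypothesis pw : forall j k f, p j (s f (w k)) = f *+ (j == k).
Hypothesis ps : forall j u f, u \in U -> p j (s f u) = f * p j u.

Definition scalar_operator (phi : 'End(W)) :=
  forall u, u \in U -> phi u \in U /\ forall f, phi (s f u) = s f (phi u).

Definition operator_mx (phi : 'End(W)) : 'M[F]_c :=
  \matrix_(j, k) p k (phi (w j)).

(** Rows hold the coordinates of the images, whence the reversed order; the hypothesis [phiM]
    further below is reversed to match. *)
Lemma operator_mxM phi psi : scalar_operator phi -> scalar_operator psi ->
  operator_mx (psi \o phi)%VF = operator_mx phi *m operator_mx psi.
Proof.
move=> Hphi Hpsi; apply/matrixP => j l; rewrite !mxE comp_lfunE.
rewrite {1}(eU (proj1 (Hphi _ (wU j)))) !linear_sum /=; apply: eq_bigr => k _.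
have [_ ->] := Hpsi _ (wU k).
by rewrite ps ?mxE //; case: (Hpsi _ (wU k)).
Qed.

Lemma operator_mxD phi psi :
  operator_mx (phi + psi) = operator_mx phi + operator_mx psi.
Proof. by apply/matrixP => j k; rewrite !mxE add_lfunE linearD. Qed.

Lemma operator_mx_scalar (phi : 'End(W)) f : (forall u, u \in U -> phi u = s f u) ->
  operator_mx phi = f%:M.
Proof.
by move=> Hphi; apply/matrixP => j k; rewrite !mxE Hphi // pw eq_sym.
Qed.

(** Transitivity of the trace. By cyclicity the j-th summand has the trace of an endomorphism of F,
    namely multiplication by g times the j-th diagonal entry of [phi]. When q maps W into U, the sum
    over j is q itself. *)
Lemma lftrace_scalar_operator phi (q : 'End(W)) g :
    scalar_operator phi -> (forall u, u \in U -> q u = u) ->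
  lftrace (s g \o phi \o (\sum_j (orbit_map (w j) \o (p j \o q))))%VF
    = falg_trace (g * \tr (operator_mx phi)).
Proof.
move=> Hphi qU; rewrite (big_morph (comp_lfun _) (comp_lfunDr _) (comp_lfun0r _ _)).
rewrite linear_sum mulr_sumr linear_sum /=.
apply: eq_bigr => j _.
rewrite comp_lfunA lftrace_comp falg_traceE; congr lftrace; apply/lfunP => f.
have [Uf cf] := Hphi _ (wU j).
have [_ sU] := stU Uf.
rewrite !comp_lfunE !lfunE /= mxE orbit_mapE cf -sM qU ?ps //.
by rewrite mulrCA mulrA.
Qed.

Lemma dim_scalars : \dim U = (c * \dim {:F})%N.
Proof.
pose h (x : {ffun 'I_c -> F}) : subvs_of U := vsproj U (\sum_j s (x j) (w j)).
have hU (x : {ffun 'I_c -> F}) : \sum_j s (x j) (w j) \in U.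
  by apply: memv_suml => j _; case: (stU (wU j)).
have lin : linear h.
  move=> k x y; rewrite -linearP /=; congr (vsproj U _).
  rewrite scaler_sumr -big_split; apply: eq_bigr => j _ /=.
  by rewrite !ffunE linearP add_lfunE scale_lfunE.
pose H := GRing.isSemilinear.Build K {ffun 'I_c -> F} (subvs_of U) _ h
  (GRing.semilinear_linear lin).
pose hl : {linear {ffun 'I_c -> F} -> subvs_of U} := HB.pack h H.
have/dim_bij_ffun : bijective hl.
  exists (fun u => [ffun j => p j (vsval u)]) => [x|u].
    apply/ffunP => j; rewrite ffunE vsprojK // linear_sum (bigD1 j) //= pw eqxx.
    by rewrite big1 ?addr0 // => k; rewrite pw eq_sym => /negPf->.
  apply/val_inj; rewrite /= vsprojK // {2}(eU (subvsP u)).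
  by apply: eq_bigr => j _; rewrite ffunE.
by rewrite card_ord dim_subvs.
Qed.

End ScalarOperators.

End Scalars.

(** * Characteristic polynomials *)

Section Polynomials.
Variable F : fieldType.
Implicit Types p q f : {poly F}.

(** Divisibility of k-th powers is divisibility of the bases, in any characteristic; this is what
    replaces division by k. *)
Lemma monic_exp_inj k p q : (0 < k)%N -> p \is monic -> q \is monic ->
  p ^+ k = q ^+ k -> p = q.
Proof.
move=> k0 mp mq e; apply/eqP; rewrite -eqp_monic //.
by rewrite /eqp -(dvdp_pexp2r p q k0) -(dvdp_pexp2r q p k0) e dvdpp.
Qed.

Lemma irreducible_factor p : (1 < size p)%N ->
  exists2 f, irreducible_poly f & f %| p.
Proof.
have [m] := ubnP (size p); elim: m p => // m IH p; rewrite ltnS => lepm lt1p.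
have [[q [q_neq1 qp nqp]]|no] :=
    classic (exists q, [/\ size q != 1%N, q %| p & ~~ (q %= p)]).
  have pn0 : p != 0 by rewrite -size_poly_gt0 ltnW.
  have ltqp : (size q < size p)%N.
    by rewrite ltn_neqAle dvdp_leq // dvdp_size_eqp // nqp.
  have qn0 : q != 0 by apply: contraNneq pn0 => q0; rewrite q0 dvd0p in qp.
  have [|f irf fq] := IH q (leq_trans ltqp lepm).
    by rewrite ltn_neqAle eq_sym q_neq1 size_poly_gt0.
  by exists f => //; apply: dvdp_trans qp.
exists p; last exact: dvdpp.
split=> // q q1 qp; apply: contraT => nqp; by case: no; exists q.
Qed.

Lemma factor_out f p : irreducible_poly f -> p != 0 ->
  exists t q, p = f ^+ t * q /\ ~~ (f %| q).
Proof.
move=> [f1 _]; have [m] := ubnP (size p); elim: m p => // m IH p.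
rewrite ltnS => lepm pn0; have [/dvdpP[q ep]|nfp] := boolP (f %| p); last first.
  by exists 0%N, p; rewrite expr0 mul1r.
have fn0 : f != 0 by rewrite -size_poly_gt0 ltnW.
have qn0 : q != 0 by apply: contraNneq pn0; rewrite ep => ->; rewrite mul0r.
have [|t [r [eq nr]]] := IH q _ qn0.
  apply: leq_trans lepm; rewrite ep size_mul //.
  by rewrite -subn1 -addnBA ?(ltnW f1) // -addn1 leq_add2l subn_gt0.
by exists t.+1, r; rewrite ep eq mulrC exprS mulrA.
Qed.

Lemma factor_out_uniq f s t p q : irreducible_poly f ->
  ~~ (f %| p) -> ~~ (f %| q) -> f ^+ s * p = f ^+ t * q -> s = t.
Proof.
move=> irf; have fn0 := irredp_neq0 irf.
wlog lst : s t p q / (s <= t)%N.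
  move=> W np nq e; case: (leqP s t) => [|/ltnW] l; first exact: W l np nq e.
  by apply/esym; apply: W l nq np (esym e).
move=> np nq e; apply/eqP; rewrite eqn_leq lst /= leqNgt; apply: contra np => l.
move: e; rewrite -(subnKC lst) exprD -mulrA => /mulfI-> //.
  by rewrite -[(t - s)%N]prednK ?subn_gt0 // exprS -mulrA dvdp_mulIl.
by rewrite expf_neq0.
Qed.

(** An irreducible factor of p occurs in p exactly once; if it occurs t times in q, comparing
    multiplicities gives t h = c. *)
Lemma separable_exp_dvd p q h c : (1 < size p)%N -> separable_poly p ->
  q ^+ h = p ^+ c -> (h %| c)%N.
Proof.
move=> lt1p sep e; have pn0 : p != 0 by rewrite -size_poly_gt0 ltnW.
have [f irf fp] := irreducible_factor lt1p.
have [h0|h0] := posnP h.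
  have /eqP := size_exp p c; rewrite -e h0 expr0 size_poly1 eq_sym muln_eq0.
  by rewrite -subn1 subn_eq0 leqNgt lt1p /= => /eqP->; apply: dvdn0.
have qn0 : q != 0.
  by apply: contraTneq (expf_neq0 c pn0) => q0; rewrite -e q0 expr0n gtn_eqF ?eqxx.
have [t [r [eq nr]]] := factor_out irf qn0.
case/dvdpP: (fp) => p' ep.
have cop g : coprimep f g = ~~ (f %| g) by apply: irreducible_poly_coprime.
have np' : ~~ (f %| p').
  by move: sep; rewrite ep separable_mul -cop coprimep_sym => /and3P[].
suff <- : (t * h)%N = c by apply: dvdn_mull.
apply: (factor_out_uniq (p := r ^+ h) (q := p' ^+ c) irf).
- by rewrite -cop coprimep_expr // cop.
- by rewrite -cop coprimep_expr // cop.
- by rewrite exprM -exprMn -eq e ep exprMn mulrC.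
Qed.

(* The subleading coefficient of a monic p, with value 0 for p = 1. *)
Definition subcoef (R : nzRingType) (p : {poly R}) : R := (p * 'X)`_(size p).-1.

End Polynomials.

(** * Recovering traces from characteristic polynomials *)

Section Subcoef.
Variable R : idomainType.
Implicit Types p q : {poly R}.

(** Up to sign [subcoef] is the sum of the roots, hence additive. The proof writes p X = X^(d+1) + a
    X^d + r with r of degree below d and reads off the coefficient of p q X. *)
Lemma subcoefM p q : p \is monic -> q \is monic ->
  subcoef (p * q) = subcoef p + subcoef q.
Proof.
move=> mp mq; have [pn0 qn0] := (monic_neq0 mp, monic_neq0 mq).
have sp : size p = (size p).-1.+1 by rewrite prednK ?size_poly_gt0.
have sq : size q = (size q).-1.+1 by rewrite prednK ?size_poly_gt0.
rewrite /subcoef size_mul //.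
move: (size p).-1 sp (size q).-1 sq => d sp e sq; rewrite sp sq addSn addnS /=.
have lp : p`_d = 1 by move/monicP: mp; rewrite lead_coefE sp.
have lq : q`_e = 1 by move/monicP: mq; rewrite lead_coefE sq.
pose a := (p * 'X)`_d; rewrite -[X in _ = X + _]/a.
pose r := p * 'X - 'X^(d.+1) - a *: 'X^d.
have sr : (size r <= d)%N.
  apply/leq_sizeP => j; rewrite leq_eqVlt => /predU1P[<-|ltdj].
    rewrite !coefB coefZ !coefXn eqxx mulr1 -/a.
    by rewrite (ltn_eqF (leqnn _)) subr0 subrr.
  rewrite !coefB coefZ !coefXn (gtn_eqF ltdj) mulr0 subr0 coefMX.
  case: j ltdj => // j; rewrite ltnS eqSS leq_eqVlt => /predU1P[<-|ltdj] /=.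
    by rewrite eqxx lp subrr.
  by rewrite (gtn_eqF ltdj) subr0 nth_default // sp.
have -> : p * q * 'X = 'X^d * (q * 'X) + (a *: ('X^d * q) + r * q).
  rewrite mulrAC.
  have -> : p * 'X = r + a *: 'X^d + 'X^(d.+1) by rewrite /r !subrK.
  rewrite !mulrDl addrC -scalerAl [X in _ + X]addrC; congr (_ + _).
  by rewrite exprSr -!mulrA [q * _]mulrC.
rewrite !coefD coefXnM addKn ltnNge leq_addr /= addrC; congr (_ + _).
rewrite coefZ coefXnM ltnNge leq_addr addKn /= lq mulr1.
rewrite [X in _ + X]nth_default ?addr0 //.
apply: leq_trans (size_polyMleq _ _) _; rewrite sq addnS /=.
by rewrite leq_add2r.
Qed.

Lemma subcoef1 : subcoef (1 : {poly R}) = 0.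
Proof. by rewrite /subcoef mul1r size_poly1 coefX. Qed.

Lemma subcoefX p k : p \is monic -> subcoef (p ^+ k) = subcoef p *+ k.
Proof.
move=> mp; elim: k => [|k IH]; first by rewrite subcoef1.
by rewrite exprS subcoefM ?monic_exp // IH mulrS.
Qed.

Lemma subcoef_prod (I : Type) (r : seq I) (f : I -> R) :
  subcoef (\prod_(i <- r) ('X - (f i)%:P)) = - \sum_(i <- r) f i.
Proof.
elim: r => [|i r IH]; first by rewrite !big_nil subcoef1 oppr0.
rewrite !big_cons subcoefM ?monicXsubC ?monic_prod_XsubC // IH opprD.
congr (_ + _); rewrite /subcoef size_XsubC coefMX /=.
by rewrite coefB coefX coefC sub0r.
Qed.

Lemma subcoef_char_poly n (A : 'M[R]_n) : subcoef (char_poly A) = - \tr A.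
Proof.
rewrite /subcoef size_char_poly coefMX.
case: n A => [|n] A /=; first by rewrite /mxtrace big_ord0 oppr0.
exact: (char_poly_trace A).
Qed.

End Subcoef.

Lemma subcoef_map (R1 : fieldType) (R2 : idomainType) (f : {rmorphism R1 -> R2}) p :
  subcoef (map_poly f p) = f (subcoef p).
Proof. by rewrite /subcoef size_map_poly -{1}(map_polyX f) -rmorphM coef_map. Qed.

(** * Characteristic polynomials in a matrix representation of a commutative ring *)

Section Representation.
Variables (L : comNzRingType) (F : fieldType) (c : nat).
Variable M : L -> 'M[F]_c.
Hypothesis MD : forall y z, M (y + z) = M y + M z.
Hypothesis MM : forall y z, M (y * z) = M y *m M z.
Hypothesis M1 : M 1 = 1%:M.

(** Viewed as a matrix of polynomials, the product of the X - M (f j) is the scalar matrix p; take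
    determinants. *)
Lemma prod_char_poly (I : Type) (r : seq I) (f : I -> L) (p : {poly F}) :
    (forall i, M (\prod_(j <- r) ('X - (f j)%:P))`_i = (p`_i)%:M) ->
  \prod_(j <- r) char_poly (M (f j)) = p ^+ c.
Proof.
(* Matrices of size 0 form the zero ring, so this case is kept apart from the ring isomorphism used
   below. *)
case: c M MD MM M1 => [|c'] N ND NM N1 eNp.
  by rewrite expr0 big1 // => j _; rewrite /char_poly det_mx00.
have N_additive : zmod_morphism N.
  by move=> y z; apply: (addIr (N z)); rewrite -ND !subrK.
have N_mult : monoid_morphism N by split.
pose HA := GRing.isZmodMorphism.Build L 'M[F]_c'.+1 N N_additive.
pose HM := GRing.isMonoidMorphism.Build L 'M[F]_c'.+1 N N_mult.
pose Nr : {rmorphism L -> 'M[F]_c'.+1} := HB.pack N HA HM.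
have [phi [phi_bij phiC phiA _]] := mx_poly_ring_isom F c'.
have e j : phi (char_poly_mx (N (f j))) = map_poly Nr ('X - (f j)%:P).
  rewrite /char_poly_mx (rmorphB phi) /= phiC phiA map_polyX.
  rewrite (rmorphB (map_poly Nr)); congr (_ - _).
    exact/esym/map_polyX.
  exact/esym/(map_polyC Nr).
have: \prod_(j <- r) char_poly_mx (N (f j)) = p%:M.
  apply: (bij_inj phi_bij); rewrite rmorph_prod phiC.
  under eq_bigr => j _ do rewrite e.
  rewrite -rmorph_prod; apply/polyP => i.
  by rewrite coef_map /= eNp coef_map.
move/(congr1 determinant); rewrite det_scalar => <-.
by rewrite (big_morph determinant (@det_mulmx _ _) (det1 _ _)).
Qed.

End Representation.

Lemma char_poly_conj (F : fieldType) c (A B T T' : 'M[F]_c) :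
  T *m T' = 1%:M -> A *m T = T *m B -> char_poly A = char_poly B.
Proof.
move=> TT' e; have {e} -> : A = T *m B *m T' by rewrite -e -mulmxA TT' mulmx1.
rewrite /char_poly.
have := TT' => /(congr1 (map_mx polyC)); rewrite map_mxM map_mx1 => tt.
have -> : char_poly_mx (T *m B *m T') =
    map_mx polyC T *m char_poly_mx B *m map_mx polyC T'.
  rewrite /char_poly_mx mulmxBr mulmxBl !map_mxM; congr (_ - _).
  by rewrite scalar_mxC -mulmxA tt mulmx1.
by rewrite !det_mulmx mulrAC -det_mulmx tt det1 mul1r.
Qed.

(** * The fixed field of a centralizer *)

Section GaloisTheory.
Variables (K : fieldType) (L : fieldExtType K) (gT : finGroupType).
Variables (a : field_action L gT) (v : gT).
Local Notation N := (act_kernel a).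
Local Notation H := 'C[v]%G.
Local Notation HN := 'C_N[v]%G.
Local Notation E := (cent_fixed_aspace a v).

Fact fact_fun_monoid s : monoid_morphism (fact_fun a s).
Proof. by split=> [|y z]; rewrite /fact_fun ?fact1 ?factM. Qed.
HB.instance Definition _ s :=
  GRing.isMonoidMorphism.Build L L (fact_fun a s) (fact_fun_monoid s).

Lemma fact_horner_fixed (p : {poly L}) y s : s \in H -> p \is a polyOver E ->
  a p.[y] s = p.[a y s].
Proof.
move=> Hs /polyOverP Ep; rewrite -[a p.[y] s]/(fact_fun a s p.[y]) -horner_map.
congr _.[_]; apply/polyP => i; rewrite coef_map /=.
exact: (cent_fixedP _ _ _ (Ep i)).
Qed.

Lemma prod_XsubC_fixed (r : seq L) :
    (forall s, s \in H -> perm_eq [seq a y s | y <- r] r) ->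
  \prod_(y <- r) ('X - y%:P) \is a polyOver E.
Proof.
move=> perm_r; apply/polyOverP => i; apply/cent_fixedP => s Hs.
rewrite -[a _ s]/(fact_fun a s _) -coef_map map_prod_XsubC /=.
transitivity ((\prod_(y <- r) ('X - (a y s)%:P))`_i); last first.
  congr _`_i; rewrite -(big_map (fun y => a y s) xpredT (fun y => 'X - y%:P)).
  by rewrite (perm_big _ (perm_r s Hs)).
by [].
Qed.

Lemma inj_map_uniq_perm (r : seq L) s :
    uniq r -> (forall y, y \in r -> a y s \in r) ->
  perm_eq [seq a y s | y <- r] r.
Proof.
move=> ur cl; have inj_s : injective (fun y => a y s).
  by move=> y z /(congr1 (fun u => a u s^-1%g)); rewrite -!factgM mulgV !factg1.
apply: uniq_perm; rewrite ?map_inj_uniq //.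
have [] // := uniq_min_size (s1 := [seq a y s | y <- r]) (s2 := r).
- by rewrite map_inj_uniq.
- by move=> _ /mapP[y ry ->]; apply: cl.
- by rewrite size_map.
Qed.

Lemma prod_action_fixed y : \prod_(s in H) ('X - (a y s)%:P) \is a polyOver E.
Proof.
rewrite -big_enum -(big_map (a y) xpredT (fun z => 'X - z%:P)).
apply: prod_XsubC_fixed => t Ht; rewrite -map_comp.
rewrite (eq_map (g := a y \o mulg^~ t)) => [|s /=]; last by rewrite factgM.
rewrite map_comp; apply/perm_map/uniq_perm.
- by rewrite map_inj_uniq ?enum_uniq //; apply: mulIg.
- exact: enum_uniq.
move=> s; rewrite mem_enum; apply/mapP/idP => [[u]|Hs].
  by rewrite mem_enum => Hu ->; rewrite groupM.
by exists (s * t^-1)%g; rewrite ?mulgKV // mem_enum groupM ?groupV.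
Qed.

(** Each y is a root of the product of X - z over its distinct conjugates z under H, whose
    coefficients are fixed by H. *)
Lemma separable_fixed : separable E {:L}.
Proof.
apply/separableP => y _; apply/separable_elementP.
pose r := undup [seq a y s | s <- enum H].
exists (\prod_(z <- r) ('X - z%:P)); split.
- apply: prod_XsubC_fixed => s Hs; apply: inj_map_uniq_perm; rewrite ?undup_uniq //.
  move=> z; rewrite !mem_undup => /mapP[t Ht ->]; apply/mapP; exists (t * s)%g.
    by rewrite mem_enum groupM // -mem_enum.
  by rewrite factgM.
- rewrite root_prod_XsubC mem_undup; apply/mapP; exists 1%g; rewrite ?factg1 //.
  by rewrite mem_enum group1.
- by rewrite separable_prod_XsubC undup_uniq.
Qed.

Let theta := separable_generator E {:L}.

Lemma theta_generates y : exists2 p, p \is a polyOver E & y = p.[theta].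
Proof.
apply/Fadjoin_polyP; have <- := eq_adjoin_separable_generator separable_fixed (subvf E).
exact: memvf.
Qed.

(** Since theta generates L over E, an element of H fixing theta acts trivially on L: the stabilizer
    of theta in H is HN. *)
Lemma fact_theta_inj s t : s \in H -> t \in H ->
  (a theta s == a theta t) = ((s * t^-1)%g \in HN).
Proof.
move=> Hs Ht; have Hst : (s * t^-1)%g \in H by rewrite groupM ?groupV.
apply/eqP/idP => [e|]; last first.
  case/setIP => /act_kernelP Nst _.
  by rewrite -[s in LHS](mulgKV t) [in LHS]factgM Nst.
rewrite inE Hst andbT; apply/act_kernelP => y.
have [p Ep ->] := theta_generates y.
by rewrite fact_horner_fixed // factgM e -factgM mulgV factg1.
Qed.

Lemma sub_cent_kernel : HN \subset H. Proof. exact: subsetIr. Qed.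

Let r := [seq a theta (repr R) | R in rcosets HN H].

Lemma repr_rcosets R : R \in rcosets HN H -> repr R \in H /\ R = (HN :* repr R)%g.
Proof.
case/rcosetsP => t Ht ->; split; last by rewrite rcoset_repr.
have /rcosetP[c /(subsetP sub_cent_kernel) Hc ->] := mem_repr_rcoset HN t.
by rewrite groupM.
Qed.

Lemma uniq_theta_orbit : uniq r.
Proof.
rewrite map_inj_in_uniq ?enum_uniq // => R1 R2; rewrite !mem_enum => R1H R2H.
case: (repr_rcosets R1H) => H1 e1; case: (repr_rcosets R2H) => H2 e2.
move/eqP; rewrite fact_theta_inj // -mem_rcoset => h.
by rewrite e1 e2; apply/rcoset_eqP.
Qed.

Lemma mem_theta_orbit s : s \in H -> a theta s \in r.
Proof.
move=> Hs; have RH : (HN :* s)%g \in rcosets HN H by apply/rcosetsP; exists s.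
apply/mapP; exists (HN :* s)%g; first by rewrite mem_enum.
have [Hr er] := repr_rcosets RH.
by apply/eqP; rewrite fact_theta_inj // -mem_rcoset -er rcoset_refl.
Qed.

Lemma theta_orbitP z : z \in r -> exists2 s, s \in H & z = a theta s.
Proof.
case/mapP => R; rewrite mem_enum => /repr_rcosets[Hr _] ->.
by exists (repr R).
Qed.

Lemma theta_poly_fixed : \prod_(z <- r) ('X - z%:P) \is a polyOver E.
Proof.
apply: prod_XsubC_fixed => s Hs; apply: inj_map_uniq_perm (uniq_theta_orbit) _.
by move=> z /theta_orbitP[t Ht ->]; rewrite -factgM mem_theta_orbit ?groupM.
Qed.

(** The product over the orbit has coefficients in E and the root theta; conversely, all conjugates
    of theta are roots of its minimal polynomial. *)
Lemma minPoly_theta : minPoly E theta = \prod_(z <- r) ('X - z%:P).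
Proof.
have rt : theta \in r by rewrite -[X in X \in _](factg1 a) mem_theta_orbit.
apply/eqP; rewrite -eqp_monic ?monic_minPoly ?monic_prod_XsubC //.
rewrite /eqp minPoly_dvdp ?theta_poly_fixed ?root_prod_XsubC //=.
apply: uniq_roots_dvdp; last by rewrite uniq_rootsE uniq_theta_orbit.
apply/allP => z /theta_orbitP[s Hs ->].
rewrite /root -fact_horner_fixed ?minPolyOver //.
by have /rootP -> := root_minPoly E theta; rewrite Defs.fact0.
Qed.

Lemma dim_cent_fixed : \dim {:L} = (#|H : HN|%g * \dim (cent_fixed a v))%N.
Proof.
have := dim_Fadjoin E theta.
rewrite -(eq_adjoin_separable_generator separable_fixed (subvf E)) => ->.
congr (_ * _)%N; apply/eqP; rewrite -eqSS -size_minPoly minPoly_theta.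
by rewrite size_prod_XsubC size_map -cardE.
Qed.

(** Each conjugate of theta arises from a full coset of HN in H. *)
Lemma prod_action_theta :
  \prod_(s in H) ('X - (a theta s)%:P) = minPoly E theta ^+ #|HN|.
Proof.
rewrite minPoly_theta (set_partition_big _ (rcosets_partition sub_cent_kernel)) /=.
rewrite big_map big_enum /= -prodrXl; apply: eq_bigr => R RH.
rewrite -[X in _ ^+ X](_ : #|R| = _); last first.
  by case/rcosetsP: RH => t _ ->; rewrite card_rcoset.
rewrite -prodr_const; apply: eq_bigr => s Rs; congr ('X - _%:P).
have [Hr eR] := repr_rcosets RH.
have /rcosetP[c cHN es] : s \in (HN :* repr R)%g by rewrite -eR.
have Hc := subsetP sub_cent_kernel _ cHN.
by apply/eqP; rewrite es fact_theta_inj ?mulgK // groupM.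
Qed.


Hypothesis n_unit : (#|N|%:R : K) \is a GRing.unit.

Lemma card_cent_unit : (#|HN|%:R : K) != 0.
Proof.
have sub : HN \subset act_kernel_group a by apply: subsetIl.
apply: contraTneq n_unit => e.
by rewrite -(Lagrange sub) natrM e mul0r unitr0.
Qed.

Definition cent_trace y := \sum_(s in H) a y s.

Lemma cent_trace_fixed y : cent_trace y \in cent_fixed a v.
Proof.
apply/cent_fixedP => t Ht; rewrite -[a _ t]/(fact_fun a t _) /cent_trace.
rewrite linear_sum [RHS](reindex_inj (mulIg t)) /=.
by apply: eq_big => s; rewrite ?groupMr // => Hs; rewrite /fact_fun -factgM.
Qed.

(** Let q be the minimal polynomial of theta divided by X - theta. It vanishes at every other
    conjugate, so the sum of q(theta^s) over H is |HN| q(theta), which is nonzero; expanding q, some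
    power of theta has nonzero [cent_trace]. *)
Lemma cent_trace_neq0 : exists w, cent_trace w != 0.
Proof.
pose q := \prod_(z <- rem theta r) ('X - z%:P).
have rt : theta \in r by rewrite -[X in X \in _](factg1 a) mem_theta_orbit.
have qtheta : q.[theta] != 0.
  rewrite -rootE root_prod_XsubC mem_rem_uniq ?uniq_theta_orbit //.
  by rewrite inE eqxx.
have qN s : s \in H -> s \notin HN -> q.[a theta s] = 0.
  move=> Hs ns; apply/rootP; rewrite root_prod_XsubC mem_rem_uniq ?uniq_theta_orbit //.
  rewrite inE mem_theta_orbit // andbT -[X in _ != X](factg1 a).
  by rewrite fact_theta_inj // invg1 mulg1.
have e : \sum_(s in H) q.[a theta s] = #|HN|%:R * q.[theta].
  rewrite (bigID (mem HN)) /= [X in _ + X]big1 ?addr0; last first.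
    by move=> s /andP[]; apply: qN.
  rewrite (eq_bigl (mem HN)) => [|s]; last first.
    rewrite -[RHS]/(s \in HN).
    by case: (boolP (s \in HN)) => [/(subsetP sub_cent_kernel) -> | _]; rewrite ?andbF.
  rewrite (eq_bigr (fun=> q.[theta])) ?sumr_const ?mulr_natl // => s hs.
  congr _.[_]; rewrite -[RHS](factg1 a); apply/eqP.
  by rewrite fact_theta_inj ?invg1 ?mulg1 // (subsetP sub_cent_kernel).
have [[i nz]|no] := pickP (fun i : 'I_(size q) => cent_trace (theta ^+ i) != 0).
  by exists (theta ^+ i).
have : #|HN|%:R * q.[theta] != 0.
  rewrite mulf_neq0 // -(rmorph_nat (in_alg L)) fmorph_eq0.
  exact: card_cent_unit.
rewrite -e; under eq_bigr => s _ do rewrite horner_coef.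
rewrite exchange_big big1 ?eqxx //= => i _; rewrite -mulr_sumr.
have /negbFE/eqP := no i; rewrite /cent_trace => e0.
suff -> : \sum_(s in H) a theta s ^+ i = 0 by rewrite mulr0.
rewrite -[RHS]e0; apply: eq_bigr => s _.
by rewrite -[RHS]/(fact_fun a s _) rmorphXn.
Qed.

(** A nonzero E-linear map to E is onto. *)
Lemma cent_trace_surj e : e \in cent_fixed a v -> exists w, cent_trace w = e.
Proof.
move=> Ee; have [w nz] := cent_trace_neq0.
pose q := e / cent_trace w; exists (w * q).
have /cent_fixedP fixq : q \in E.
  by rewrite rpred_div //; apply: cent_trace_fixed.
have -> : e = cent_trace w * q by rewrite /q mulrCA mulfV ?mulr1.
rewrite /cent_trace mulr_suml; apply: eq_bigr => s Hs.
by rewrite factM fixq.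
Qed.

(** * F-spaces with an action of L and compatible semilinear twists by H *)

Section SemilinearModule.
Variables (F : fieldExtType K) (W : vectType K) (s : F -> 'End(W)).
Hypothesis s_linear : linear s.
Hypothesis sM : forall f g w, s (f * g) w = s f (s g w).
Variables (U : {vspace W}) (c : nat) (w : 'I_c -> W) (p : 'I_c -> 'Hom(W, F)).
Hypotheses (stU : unital_stable s U) (wU : forall j, w j \in U).
Hypothesis eU : forall u, u \in U -> u = \sum_j s (p j u) (w j).
Hypothesis pw : forall j k f, p j (s f (w k)) = f *+ (j == k).
Hypothesis ps : forall j u f, u \in U -> p j (s f u) = f * p j u.

Variables (phi : L -> 'End(W)) (T : gT -> 'End(W)).
Hypothesis phiD : forall y z, phi (y + z) = phi y + phi z.
Hypothesis phiM : forall y z, phi (y * z) = (phi z \o phi y)%VF.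
Hypothesis phi1 : forall u, u \in U -> phi 1 u = u.
Hypothesis phi_op : forall y, scalar_operator s U (phi y).
Hypothesis T_op : forall t, t \in H -> scalar_operator s U (T t).
Hypothesis TV : forall t u, u \in U -> T t^-1%g (T t u) = u.
Hypothesis T_phi : forall t y u, u \in U -> T t (phi y u) = phi (a y t) (T t u).

Variables (K' : fieldType) (kappa : {rmorphism K' -> L}).
Variable (iota : {rmorphism K' -> F}).
Hypothesis kappa_over : forall m : {poly L}, m \is a polyOver E ->
  exists q, m = map_poly kappa q.
Hypothesis phi_kappa : forall e u, u \in U -> phi (kappa e) u = s (iota e) u.

Local Notation M y := (operator_mx w p (phi y)).

(** The matrix of T t conjugates one into the other. *)
Lemma char_poly_twist t y : t \in H -> char_poly (M y) = char_poly (M (a y t)).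
Proof.
move=> Ht; have HtV : t^-1%g \in H by rewrite groupV.
have opt := T_op Ht; have optV := T_op HtV.
apply: (@char_poly_conj _ _ _ _ (operator_mx w p (T t))
                        (operator_mx w p (T t^-1%g))).
  rewrite -(operator_mxM (U := U) (s := s)) //.
  apply: (operator_mx_scalar wU pw) => u Uu.
  by rewrite comp_lfunE TV //; case: (stU Uu).
rewrite -!(operator_mxM (U := U) (s := s)) //.
by apply/matrixP => j k; rewrite !mxE !comp_lfunE T_phi.
Qed.

(** All conjugates of y share one characteristic polynomial, so its |H|-th power is a product over
    H; as the coefficients of q act as scalars, [prod_char_poly] evaluates that product. *)
Lemma char_poly_semilinear y (q : {poly K'}) :
    \prod_(t in H) ('X - (a y t)%:P) = map_poly kappa q ->
  char_poly (M y) ^+ #|H| = map_poly iota q ^+ c.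
Proof.
move=> eq_q.
have MM y1 y2 : M (y1 * y2) = M y1 *m M y2.
  by rewrite phiM (operator_mxM (U := U) (s := s)).
have MD y1 y2 : M (y1 + y2) = M y1 + M y2 by rewrite phiD operator_mxD.
have M1 : M 1 = 1%:M.
  by apply: (operator_mx_scalar wU pw) => u Uu; rewrite phi1 //; case: (stU Uu).
rewrite -(prod_char_poly MD MM M1 (r := enum H) (f := a y)).
  rewrite big_enum -prodr_const; apply: eq_bigr => t Ht; exact: char_poly_twist.
move=> i; rewrite big_enum eq_q !coef_map.
exact: (operator_mx_scalar wU pw) (phi_kappa _).
Qed.

(** For theta, cancelling the exponent |HN| leaves chi^[H : HN] = mu^c, where mu is the separable
    minimal polynomial; [separable_exp_dvd] applies. *)
Lemma semilinear_rank : (#|H : HN|%g %| c)%N.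
Proof.
have [mu emu] := kappa_over (minPolyOver E theta).
have HNgt0 : (0 < #|HN|)%N by apply: cardG_gt0.
have mon_mu : mu \is monic by rewrite -(map_monic kappa) -emu monic_minPoly.
have := @char_poly_semilinear theta (mu ^+ #|HN|).
rewrite prod_action_theta emu (rmorphXn (map_poly kappa)) => /(_ erefl).
rewrite -(Lagrange sub_cent_kernel) rmorphXn /= !exprM => e.
apply: (@separable_exp_dvd _ (map_poly iota mu) (char_poly (M theta))).
- by rewrite size_map_poly -(size_map_poly kappa) -emu size_minPoly.
- rewrite separable_map -(separable_map kappa) -emu.
  by rewrite minPoly_theta separable_prod_XsubC uniq_theta_orbit.
apply: (monic_exp_inj HNgt0); rewrite ?monic_exp ?char_poly_monic ?map_monic //.
by rewrite -!exprM mulnC [(c * _)%N]mulnC !exprM.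
Qed.

(** The [H : HN]-th root is taken among monic polynomials, and only then are subleading coefficients
    compared; comparing them earlier would lose information when [H : HN] is zero in F. *)
Lemma semilinear_trace y k : cent_trace y = kappa k ->
  #|HN|%:R * \tr (M y) = (c %/ #|H : HN|%g)%:R * iota k.
Proof.
move=> ek; have [q eq_q] := kappa_over (prod_action_fixed y).
have mon_q : q \is monic by rewrite -(map_monic kappa) -eq_q monic_prod_XsubC.
have := char_poly_semilinear eq_q.
set rk := (c %/ _)%N.
have -> : map_poly iota q ^+ c = (map_poly iota q ^+ rk) ^+ #|H : HN|%g.
  by rewrite -exprM divnK ?semilinear_rank.
rewrite -(Lagrange sub_cent_kernel) exprM => e.
have HNgt0 : (0 < #|HN|)%N by apply: cardG_gt0.
have {}e : char_poly (M y) ^+ #|HN| = map_poly iota q ^+ rk.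
  apply: monic_exp_inj (indexg_gt0 H HN) _ _ e.
    by rewrite monic_exp ?char_poly_monic.
  by rewrite monic_exp ?map_monic.
have := congr1 (@subcoef _) e.
rewrite !subcoefX ?char_poly_monic ?map_monic // subcoef_char_poly subcoef_map.
have -> : subcoef q = - k.
  apply: (fmorph_inj kappa); rewrite rmorphN -ek /cent_trace -big_enum.
  by rewrite -subcoef_prod big_enum /= eq_q subcoef_map.
rewrite rmorphN !mulNrn => /oppr_inj.
by rewrite !mulr_natl.
Qed.

End SemilinearModule.

End GaloisTheory.

(** * Traces from L to L_v and to K in terms of sums of conjugates *)

Section TraceTower.
Variables (K : fieldType) (L : fieldExtType K) (gT : finGroupType).
Variable a : field_action L gT.
Local Notation N := (act_kernel a).

(** Transitivity of the trace reduces this to the trace over L_v of multiplication by y. For that,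
    [semilinear_trace] is applied to L as an L_v-space; its rank is [C_G(v) : C_N(v)], so the factor
    c/[H : HN] is 1. *)
Lemma trace_tower v y : #|'C_N[v]|%g%:R * falg_trace y =
  falg_trace (vsproj (cent_fixed_aspace a v) (cent_trace a v y)).
Proof.
pose F := subvs_of (cent_fixed_aspace a v).
pose s (f : F) : 'End(L) := amulr (vsval f).
have s_linear : linear s by move=> k f g; rewrite /s !linearP.
have sM f g z : s (f * g) z = s f (s g z).
  by rewrite !lfunE /= mulrA mulrAC.
have stU : unital_stable s {:L}.
  by move=> u _; split=> [|f]; rewrite ?memvf // lfunE /= algid1 mulr1.
have [c [w [p [wU eU pw ps]]]] := scalars_basis s_linear sM stU.
have dimL := dim_scalars s_linear stU wU eU pw.
have h_gt0 : (0 < #|'C[v] : 'C_N[v]|%g)%N by rewrite indexg_gt0.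
have E_gt0 : (0 < \dim (cent_fixed a v))%N by rewrite adim_gt0.
have ec : c = #|'C[v] : 'C_N[v]|%g.
  apply/eqP; move/eqP: dimL.
  by rewrite (dim_cent_fixed a v) dim_subvs eqn_pmul2r // eq_sym.
pose phi (y : L) : 'End(L) := amulr y.
have phi_op z : scalar_operator s {:L} (phi z).
  by move=> u _; split=> [|f]; rewrite ?memvf // !lfunE /= mulrAC.
pose T t : 'End(L) := galop a t.
have T_op t : t \in 'C[v]%g -> scalar_operator s {:L} (T t).
  move=> Ct u _; split=> [|f]; rewrite ?memvf // [s _ _]lfunE [RHS]lfunE /=.
  by rewrite /T !galopE factM (cent_fixedP _ _ _ (subvsP f)).
have sum_id : \sum_j (orbit_map s (w j) \o (p j \o \1))%VF = \1%VF :> 'End(L).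
  apply/lfunP => u; rewrite sum_lfunE lfunE /= {2}(eU u (memvf _)).
  by apply: eq_bigr => j _; rewrite !comp_lfunE lfunE orbit_mapE.
have s1 : s 1 = \1%VF by apply/lfunP => u; rewrite !lfunE /= algid1 mulr1.
have := lftrace_scalar_operator s_linear sM stU wU ps 1 (phi_op y) (q := \1%VF).
rewrite s1 sum_id comp_lfun1r comp_lfun1l mul1r => eqtr.
rewrite [falg_trace y]eqtr; last by move=> u _; rewrite lfunE.
pose e := vsproj (cent_fixed_aspace a v) (cent_trace a v y).
have phiD y1 y2 : phi (y1 + y2) = phi y1 + phi y2 by rewrite /phi linearD.
have phiM y1 y2 : phi (y1 * y2) = (phi y2 \o phi y1)%VF.
  by apply/lfunP => u; rewrite !lfunE /= !lfunE /= mulrA.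
have phi1 u : u \in {:L}%VS -> phi 1 u = u by rewrite lfunE /= mulr1.
have TV t u : u \in {:L}%VS -> T t^-1%g (T t u) = u.
  by rewrite /T !galopE -factgM mulgV factg1.
have T_phi t z u : u \in {:L}%VS -> T t (phi z u) = phi (a z t) (T t u).
  by rewrite /T !galopE !lfunE /= factM.
have kap (m : {poly L}) : m \is a polyOver (cent_fixed_aspace a v) ->
  exists q : {poly F}, m = map_poly vsval q by move/polyOver_subvs.
have phik (f : F) u : u \in {:L}%VS -> phi (vsval f) u = s (idfun f) u by [].
have ek : cent_trace a v y = vsval e by rewrite vsprojK // cent_trace_fixed.
have := semilinear_trace stU wU eU pw ps phiD phiM phi1 phi_op T_op TV T_phi
  (iota := idfun) kap phik ek.
have -> : (c %/ #|'C[v] : 'C_N[v]|%g)%N = 1%N by rewrite ec divnn h_gt0.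
rewrite mul1r /= -/e => <-.
by rewrite !mulr_natl raddfMn.
Qed.

Lemma cent_fixed1 : cent_fixed a 1%g = 1%VS.
Proof.
apply/vspaceP => z; apply/idP/idP => [/cent_fixedP fz|/(fact_fixed a) fz].
  by apply/(fact_fixed a) => s; apply: fz; rewrite cent11T inE.
by apply/cent_fixedP => s _; apply: fz.
Qed.

Lemma dim_galois : \dim {:L} = #|'C[1%g] : 'C_N[1%g]|%g.
Proof. by rewrite (dim_cent_fixed a 1%g) cent_fixed1 dimv1 muln1. Qed.

(** This is [trace_tower] at v = 1, where L_v is the image of K. *)
Lemma galois_trace y : (#|N|%:R * falg_trace y)%:A = \sum_s a y s.
Proof.
have C1 : 'C[1%g : gT]%g = [set: gT] by rewrite cent11T.
have := trace_tower 1%g y; rewrite C1 setIT => ->.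
have -> : \sum_s a y s = cent_trace a 1%g y.
  by apply: eq_bigl => s; rewrite /= C1 inE.
have := cent_trace_fixed a 1%g y; move: (cent_trace _ _ _) => e Ee.
have /vlineP[k ek] : e \in (1%VS : {vspace L}).
  by apply/fact_fixed => s; apply: (cent_fixedP _ _ _ Ee); rewrite C1 inE.
have -> : vsproj (cent_fixed_aspace a 1%g) e = k%:A.
  by apply/val_inj; rewrite /= vsprojK // ek algid1.
by rewrite falg_trace_scalar dim_subvs /= cent_fixed1 dimv1 mul1r ek.
Qed.
End TraceTower.

(** * The central form *)

Section CentralFormula.
Variables (K : fieldType) (L : fieldExtType K) (gT : finGroupType).
Variable a : field_action L gT.
Local Notation A := (twisted_ring a).
Local Notation N := (act_kernel a).
Implicit Types f g : A.

Lemma tw_mulr_coef f t z r : (f * tw a t z) r = a (f (r * t^-1)%g) t * z.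
Proof.
rewrite ffunE (bigD1 t) //= ffunE eqxx big1 ?addr0 // => u /negPf ut.
by rewrite ffunE ut mulr0.
Qed.

Lemma tw_mull_coef f t z r :
  (tw a t z * f) r = a z (t^-1 * r)%g * f (t^-1 * r)%g.
Proof.
rewrite ffunE (bigD1 (t^-1 * r)%g) //= ffunE invMg invgK mulKVg eqxx.
rewrite big1 ?addr0 // => u ut; rewrite ffunE.
case: eqP => [e|_]; last by rewrite Defs.fact0 mul0r.
by case/eqP: ut; rewrite -e invMg invgK mulgKV.
Qed.

Lemma act_kernelJ s t : (s ^ t \in N)%g = (s \in N).
Proof.
have sub u v : u \in N -> (u ^ v)%g \in N.
  move=> /act_kernelP Nu; apply/act_kernelP => y.
  by rewrite conjgE !factgM Nu -factgM mulVg factg1.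
by apply/idP/idP; [rewrite -{2}[s](conjgK t)|]; apply: sub.
Qed.

Lemma centralP f : f \in 'Z({:A})%AS -> forall g, f * g = g * f.
Proof. by case/memv_capP=> _ /centvP fC g; rewrite fC ?memvf. Qed.

(** Commuting with y in L gives y^s f(s) = y f(s). Commuting with group elements gives
    [central_conj]. *)
Lemma central_support f s : f \in 'Z({:A})%AS -> s \notin N -> f s = 0.
Proof.
move=> /centralP fC; apply: contraNeq => nz; apply/act_kernelP => y.
have := congr1 (fun g : A => g s) (fC (tw a 1%g y)).
rewrite tw_mulr_coef tw_mull_coef invg1 mulg1 mul1g factg1 mulrC.
by move/(mulIf nz).
Qed.

Lemma central_conj f s t : f \in 'Z({:A})%AS -> f (s ^ t)%g = a (f s) t.
Proof.
move=> /centralP fC; have := congr1 (fun g : A => g (s * t)%g) (fC (tw a t 1)).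
by rewrite tw_mulr_coef tw_mull_coef mulgK mulr1 fact1 mul1r -conjgE => ->.
Qed.

Lemma central_cent_fixed f s : f \in 'Z({:A})%AS -> f s \in cent_fixed a s.
Proof.
move=> fZ; apply/cent_fixedP => t /cent1P st.
by rewrite -central_conj // conjgE -st mulKg.
Qed.

Lemma repr_cent_rcosets (v : gT) R : R \in rcosets 'C[v] [set: gT] -> repr R \in R.
Proof. by case/rcosetsP=> t _ ->; apply: mem_repr_rcoset. Qed.

Lemma class_sum_coef v y t : y \in cent_fixed a v ->
  class_sum a v y (v ^ t)%g = a y t.
Proof.
move=> fy; rewrite /class_sum sum_ffunE.
have Rt : ('C[v] :* t)%g \in rcosets 'C[v] [set: gT].
  by apply/rcosetsP; exists t; rewrite ?inE.
rewrite (bigD1 ('C[v] :* t)%g) //=.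
rewrite (class_sum_term fy Rt (rcoset_refl _ _)) ffunE eqxx big1 ?addr0 //.
move=> R /andP[RC ne]; rewrite ffunE; case: eqP => // e; case/eqP: ne.
have := repr_cent_rcosets RC; case/rcosetsP: (RC) => u _ -> in e *.
move: (repr _) e => r e; case/rcosetP=> c Cc er.
have /rcoset_eqP -> : t \in ('C[v] :* r)%g.
  rewrite mem_rcoset; apply/cent1P.
  have {}e : (v ^ (t * r^-1) = v)%g by rewrite conjgM e conjgK.
  by rewrite /commute -{1}e conjgE mulKVg.
by apply/esym/rcoset_eqP; rewrite er mem_rcoset mulgK.
Qed.

Lemma class_sum_coef0 v y r : r \notin (v ^: [set: gT])%g ->
  class_sum a v y r = 0.
Proof.
move=> nr; rewrite /class_sum sum_ffunE big1 // => R _; rewrite ffunE.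
case: eqP => // e; case/negP: nr; rewrite e.
by apply/imsetP; exists (repr R); rewrite ?inE.
Qed.

Lemma sum_class_sum v y : \sum_r class_sum a v y r =
  \sum_(R in rcosets 'C[v] [set: gT]) a y (repr R).
Proof.
under eq_bigr => r _ do rewrite /class_sum sum_ffunE.
rewrite exchange_big /=; apply: eq_bigr => R _.
rewrite (bigD1 (v ^ repr R)%g) //= ffunE eqxx big1 ?addr0 // => r ne.
by rewrite ffunE (negPf ne).
Qed.

Lemma central_decomposition f : f \in 'Z({:A})%AS ->
  f = \sum_(C in classes [set: gT] | repr C \in N) class_sum a (repr C) (f (repr C)).
Proof.
move=> fZ; apply/ffunP => r; rewrite sum_ffunE.
have [Nr|nr] := boolP (r \in N); last first.
  rewrite (central_support fZ nr) big1 // => C /andP[_ NC].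
  rewrite class_sum_coef0 //; apply: contra nr => /imsetP[t _ ->].
  by rewrite act_kernelJ.
have Cr : (r ^: [set: gT])%g \in classes [set: gT] by rewrite mem_classes ?inE.
have /imsetP[t _ er] : repr (r ^: [set: gT])%g \in (r ^: [set: gT])%g.
  exact: (mem_repr r (class_refl _ _)).
rewrite (bigD1 (r ^: [set: gT])%g) /= ?Cr ?er ?act_kernelJ //.
have := class_sum_coef t^-1%g (central_cent_fixed (r ^ t)%g fZ).
rewrite conjgK central_conj // -factgM mulgV factg1 => ->.
rewrite big1 ?addr0 //.
move=> C /andP[/andP[/imsetP[u _ eC] _] ne]; rewrite class_sum_coef0 //.
apply: contra ne => rC; rewrite eC.
have /imsetP[z _ ez] : repr C \in (u ^: [set: gT])%g.
  by rewrite eC; apply: (mem_repr u (class_refl _ _)).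
have: r \in (u ^: [set: gT])%g.
  case/imsetP: rC => w _ ->; rewrite ez -conjgM.
  by apply/imsetP; exists (z * w)%g; rewrite ?inE.
by move/class_eqP->.
Qed.

Lemma conj_cent_fixed v y t : y \in cent_fixed a v ->
  a y t \in cent_fixed a (v^-1 ^ t)%g.
Proof.
move=> fy; apply/cent_fixedP => c.
rewrite cent1J mem_conjg cent1C groupV cent1C => Cc.
rewrite -factgM -[(t * c)%g](mulgKV t) factgM.
have -> : (t * c * t^-1 = c ^ t^-1)%g by rewrite conjgE invgK mulgA.
by rewrite (cent_fixedP _ _ _ fy).
Qed.

(** Only pairs r, r^-1 contribute at 1, and r^-1 acts trivially on L whenever it is conjugate to v'.
    So the classes of v and v'^-1 must agree, and then the coefficients at v^s and at its inverse
    are y^s and y'^(t s). *)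
Lemma class_sum_mul_coef v v' y y' : v' \in N ->
    y \in cent_fixed a v -> y' \in cent_fixed a v' ->
  (forall t, v = (v'^-1 ^ t)%g -> (class_sum a v y * class_sum a v' y') 1%g =
     \sum_(R in rcosets 'C[v] [set: gT]) a (y * a y' t) (repr R)) /\
  ((forall t, v <> (v'^-1 ^ t)%g) -> (class_sum a v y * class_sum a v' y') 1%g = 0).
Proof.
move=> Nv' fy fy'.
have e1 : (class_sum a v y * class_sum a v' y') 1%g =
    \sum_r class_sum a v y r * class_sum a v' y' r^-1%g.
  rewrite ffunE (reindex_inj invg_inj) /=; apply: eq_bigr => r _.
  rewrite invgK mul1g.
  have [/imsetP[s _ ->]|nc] := boolP (r^-1 \in v' ^: [set: gT])%g; last first.
    by rewrite (class_sum_coef0 _ nc) !mulr0.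
  have /act_kernelP -> // : (v' ^ s)%g \in N by rewrite act_kernelJ.
split=> [t ev|nconj]; rewrite e1.
  rewrite -(sum_class_sum v); apply: eq_bigr => r _.
  have fy't : a y' t \in cent_fixed a v.
    by rewrite ev; apply: conj_cent_fixed.
  have [/imsetP[s _ ->]|nc] := boolP (r \in v ^: [set: gT])%g; last first.
    by rewrite !(class_sum_coef0 _ nc) mul0r.
  rewrite !class_sum_coef ?rpredM // factM; congr (_ * _).
  have -> : ((v ^ s)^-1 = v' ^ (t * s))%g by rewrite ev conjgM -!conjVg invgK.
  by rewrite class_sum_coef // factgM.
rewrite big1 // => r _.
have [/imsetP[s _ er]|nc] := boolP (r \in v ^: [set: gT])%g; last first.
  by rewrite (class_sum_coef0 _ nc) mul0r.
have [/imsetP[u _ er']|nc] := boolP (r^-1 \in v' ^: [set: gT])%g; last first.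
  by rewrite (class_sum_coef0 _ nc) mulr0.
case: (nconj (u * s^-1)%g).
by rewrite conjgM conjVg -er' invgK er conjgK.
Qed.

Hypothesis n_unit : (#|N|%:R : K) \is a GRing.unit.

(** Writing u as the [cent_trace] of u w, with [cent_trace] of w equal to 1, turns the left side by
    [trace_tower] into n Tr_{L/K}(u w), a sum over G, which is then grouped by cosets of C_G(v). *)
Lemma trace_cent_fixed v u : u \in cent_fixed a v ->
  (#|N : 'C_N[v]|%g%:R * falg_trace (vsproj (cent_fixed_aspace a v) u))%:A =
  \sum_(R in rcosets 'C[v] [set: gT]) a u (repr R).
Proof.
move=> fu; have [w ew] := cent_trace_surj n_unit (mem1v (cent_fixed_aspace a v)).
have fix_tr y : cent_trace a v (u * y) = u * cent_trace a v y.
  rewrite /cent_trace mulr_sumr; apply: eq_bigr => s Cs.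
  by rewrite factM (cent_fixedP _ _ _ fu).
have := trace_tower a v (u * w); rewrite fix_tr ew mulr1 => <-.
have subN : 'C_N[v]%g \subset act_kernel_group a by apply: subsetIl.
rewrite mulrA -natrM mulnC (Lagrange subN) galois_trace.
have -> : \sum_s a (u * w) s = \sum_(s in [set: gT]) a (u * w) s.
  by apply: eq_bigl => s; rewrite inE.
rewrite (set_partition_big _ (rcosets_partition (subsetT 'C[v]%G))) /=.
apply: eq_bigr => R /rcosetsP[t _ ->].
set r := repr _; have -> : ('C[v] :* t = 'C[v] :* r)%g by rewrite /r rcoset_repr.
rewrite -[RHS]mulr1 -(fact1 a r) -ew -factM -fix_tr.
rewrite -[RHS]/(fact_fun a r _) /cent_trace linear_sum /fact_fun.
rewrite (reindex_inj (mulIg r)) /=.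
by apply: eq_big => c; rewrite ?factgM // mem_rcoset mulgK.
Qed.

(** Both sides are bilinear and the class sums span the centre; on class sums [class_sum_mul_coef]
    and [trace_cent_fixed] match the defining values. *)
Lemma central_form_coef (B : {biscalar (central A)}) : is_central_form B ->
  forall xi xi', (B xi xi')%:A = (vsval xi * vsval xi') 1%g.
Proof.
move=> HB xi xi'.
(* Using [vsproj] avoids carrying a centrality proof in the summand; [csE] supplies it on P. *)
pose cs (x : A) (C : {set gT}) : central A :=
  vsproj 'Z({:A})%AS (class_sum a (repr C) (x (repr C))).
pose P (C : {set gT}) := (C \in classes [set: gT]) && (repr C \in N).
have csE (x : central A) C : P C ->
    vsval (cs (vsval x) C) = class_sum a (repr C) (vsval x (repr C)).
  case/andP=> _ NC; rewrite vsprojK //; apply: class_sum_central => //.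
  exact: (central_cent_fixed _ (subvsP x)).
have dec (x : central A) : x = \sum_(C | P C) cs (vsval x) C.
  apply/val_inj; rewrite /= linear_sum /= {1}(central_decomposition (subvsP x)).
  by apply: eq_bigr => C PC; rewrite csE.
have coef1_sum (I : finType) (Q : pred I) (F : I -> A) :
  (\sum_(i | Q i) F i) 1%g = \sum_(i | Q i) F i 1%g by rewrite sum_ffunE.
rewrite {1}[xi]dec {1}[xi']dec [vsval xi in RHS](congr1 vsval (dec xi)).
rewrite [vsval xi' in RHS](congr1 vsval (dec xi')).
rewrite linear_sumlz scaler_suml !linear_sum /= mulr_suml coef1_sum.
apply: eq_bigr => C PC.
rewrite linear_sum scaler_suml mulr_sumr coef1_sum; apply: eq_bigr => C' PC'.
rewrite !csE //; case/andP: (PC) => _ NC; case/andP: (PC') => _ NC'.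
have fy := central_cent_fixed (repr C) (subvsP xi).
have fy' := central_cent_fixed (repr C') (subvsP xi').
have [c0 c1] := class_sum_mul_coef NC' fy fy'.
have := HB _ _ _ _ NC NC' fy fy'; cbv zeta => -[b0 b1].
have toS (x : central A) D (ND : repr D \in N)
    (f : vsval x (repr D) \in cent_fixed a (repr D)) :
    cs (vsval x) D = Subvs (class_sum_central ND f).
  by apply/val_inj; rewrite /= vsprojK // class_sum_central.
rewrite (toS _ _ NC fy) (toS _ _ NC' fy').
have [t et|no] := pickP (fun t => repr C == ((repr C')^-1 ^ t)%g).
  have /eqP et' := et.
  rewrite (c0 t et') -trace_cent_fixed.
    by congr (_ *: 1); apply: b0.
  by rewrite rpredM //; move/eqP: et => ->; apply: conj_cent_fixed.
have {}no t : repr C <> ((repr C')^-1 ^ t)%g.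
  by move=> e; have := no t; rewrite -e eqxx.
by rewrite c1 // -[RHS](scale0r 1); congr (_ *: 1); apply: b1.
Qed.

End CentralFormula.

(** * Modules: density and semisimplicity *)

Section Modules.
Variables (K : fieldType) (A : falgType K).

Section ActionLinear.
Variable X : rmodule A.

Fact ract_is_linear (u : X) : linear (ract u).
Proof. by move=> k x y; rewrite ractDr ract_scaler. Qed.
HB.instance Definition _ (u : X) := GRing.isSemilinear.Build K A X _ (ract u)
  (GRing.semilinear_linear (ract_is_linear u)).

Lemma ract0l (x : A) : ract (0 : X) x = 0.
Proof. exact: (linear0 (@rmul K A X x)). Qed.

Lemma ract_suml (I : finType) (F : I -> X) (x : A) :
  ract (\sum_i F i) x = \sum_i ract (F i) x.
Proof. exact: (linear_sum (@rmul K A X x)). Qed.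

End ActionLinear.

Lemma simple_cyclic (X : simple_rmodule A) (u w : X) : u != 0 ->
  exists x, ract u x = w.
Proof.
move=> nzu; have [_ /(_ (limg (linfun (ract u))))] := srmod_simple X.
case.
- move=> _ y /memv_imgP[x _ ->]; rewrite lfunE /= -ractM.
  by apply/memv_imgP; exists (x * y); rewrite ?memvf // lfunE.
- move=> e0; case/eqP: nzu; apply/eqP; rewrite -memv0 -e0.
  by apply/memv_imgP; exists 1; rewrite ?memvf // lfunE /= ract1.
move=> e1; have := memvf w; rewrite -e1 => /memv_imgP[x _ ->].
by exists x; rewrite lfunE.
Qed.

Lemma schur_iso (X Y : simple_rmodule A) (f : 'Hom(X, Y)) :
  (forall u x, f (ract u x) = ract (f u) x) -> f != 0 -> module_iso X Y.
Proof.
move=> fA nzf; exists f; split=> //.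
have ker0 : lker f == 0%VS.
  have [_ /(_ (lker f))] := srmod_simple X; case=> [u x|->//|e].
    by rewrite !memv_ker fA => /eqP->; rewrite ract0l.
  case/eqP: nzf; apply/lfunP => u; rewrite lfunE; apply/eqP.
  by rewrite -memv_ker e memvf.
have im1 : limg f = fullv.
  have [_ /(_ (limg f))] := srmod_simple Y; case=> //.
    move=> _ x /memv_imgP[u _ ->]; rewrite -fA; exact: memv_img (memvf _).
  move=> e; case/eqP: nzf; apply/lfunP => u; rewrite lfunE; apply/eqP.
  by rewrite -memv0 -e memv_img ?memvf.
exists (f^-1)%VF => u; first exact: lker0_lfunK.
by apply: limg_lfunVK; rewrite im1 memvf.
Qed.

(** * Jacobson density for finitely many pairwise non-isomorphic simple modules *)

Section Density.
Variables (k : nat) (X : 'I_k -> simple_rmodule A) (x : 'I_k -> nat).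
Hypothesis X_distinct : forall i j, module_iso (X i) (X j) -> i = j.
Variable b : forall i, 'I_(x i) -> X i.
Hypothesis b_free : forall i, injective (fun c : {ffun 'I_(x i) -> endo (X i)} =>
  \sum_j endo_app (c j) (b j)).

Let T := {i : 'I_k & 'I_(x i)}.
Let v (t : T) : X (tag t) := b (tagged t).

(** Boolean, so that [xchoose] can select an interpolating element. *)
Let interpolates (S : {set T}) (s : T) (w : X (tag s)) (y : A) :=
  (ract (v s) y == w) && [forall s' in S, (s' != s) ==> (ract (v s') y == 0)].

Let interpolatesP (S : {set T}) (s : T) (w : X (tag s)) (y : A) :
  reflect (ract (v s) y = w /\
           forall s', s' \in S -> s' != s -> ract (v s') y = 0)
          (interpolates S w y).
Proof.
apply: (iffP andP) => [[/eqP e /forall_inP z]|[e z]]; split=> //.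
- by move=> s' Ss' ne; have := z _ Ss'; rewrite ne => /eqP.
- exact/eqP.
by apply/forall_inP => s' Ss'; apply/implyP => ne; apply/eqP/z.
Qed.

(** If whatever kills all v_s' with s' in S also kills v_t, then w |-> v_t y, for any y
    interpolating w, is well defined and A-linear. *)
Lemma density_hom (S : {set T}) (s t : T) : s \in S ->
    (forall w : X (tag s), exists y, interpolates S w y) ->
    (forall y, (forall s', s' \in S -> ract (v s') y = 0) -> ract (v t) y = 0) ->
  exists f : 'Hom(X (tag s), X (tag t)),
    (forall u y, f (ract u y) = ract (f u) y) /\
    forall w y, interpolates S w y -> f w = ract (v t) y.
Proof.
move=> Ss ex killS; pose g w : A := xchoose (ex w).
have gP (w : X (tag s)) : interpolates S w (g w) by apply: (xchooseP (ex w)).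
have uniq_y (w : X (tag s)) y y' : interpolates S w y -> interpolates S w y' ->
    ract (v t) y = ract (v t) y'.
  move=> /interpolatesP[e z] /interpolatesP[e' z'].
  apply/eqP; rewrite -subr_eq0 -(linearB (ract (v t))) /=; apply/eqP/killS.
  move=> s' Ss'; rewrite linearB /=; have [es|ne] := eqVneq s' s.
    by rewrite es e e' subrr.
  by rewrite z // z' // subrr.
have gL : linear (fun w => ract (v t) (g w)).
  move=> q w w'; rewrite -(linearP (ract (v t))) /=; apply: (uniq_y (q *: w + w')) => //.
  have /interpolatesP[e z] := gP w; have /interpolatesP[e' z'] := gP w'.
  apply/interpolatesP; split; first by rewrite linearP /= e e'.
  by move=> s' Ss' ne; rewrite linearP /= z // z' // scaler0 addr0.
pose H := GRing.isSemilinear.Build K (X (tag s)) (X (tag t)) _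
  (fun w => ract (v t) (g w)) (GRing.semilinear_linear gL).
pose h : {linear X (tag s) -> X (tag t)} :=
  HB.pack (fun w => ract (v t) (g w)) H.
have hE w : linfun h w = ract (v t) (g w) by rewrite lfunE.
exists (linfun h); split=> [u y|w y iy]; rewrite !hE; last exact: uniq_y iy.
rewrite -ractM; apply: (uniq_y (ract u y)) => //.
have /interpolatesP[e z] := gP u.
apply/interpolatesP; split; first by rewrite ractM e.
by move=> s' Ss' ne; rewrite ractM z // ract0l.
Qed.

Let spanned (t : T) (u : X (tag t)) :=
  exists2 c : {ffun 'I_(x (tag t)) -> endo (X (tag t))},
    c (tagged t) = 0 & u = \sum_j endo_app (c j) (b j).

(** By Schur a nonzero f forces s and t to belong to the same module; f is then a skew field
    coefficient at an index other than that of t. *)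
Lemma spanned_hom (s t : T) (f : 'Hom(X (tag s), X (tag t))) : s != t ->
  (forall u y, f (ract u y) = ract (f u) y) -> spanned (f (v s)).
Proof.
case: s t f => [i' j'] [i j] /= f ne fA; rewrite /spanned /=.
have [->|nzf] := eqVneq f 0.
  exists 0; rewrite ?ffunE // lfunE /= big1 // => l _.
  by rewrite /endo_app ffunE lfunE.
have ei := X_distinct (schur_iso fA nzf).
subst i'; have fE : f \in endo_space (X i) by apply/endo_spaceP.
have nej : j' != j by apply: contraNneq ne => ->.
exists [ffun l => if l == j' then Subvs fE : endo (X i) else 0].
  by rewrite ffunE eq_sym (negPf nej).
rewrite (bigD1 j') //= ffunE eqxx big1 ?addr0 // => l /negPf nl.
by rewrite ffunE nl /endo_app lfunE.
Qed.

Lemma not_spanned (t : T) : ~ spanned (v t).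
Proof.
case: t => i j [c /= c0]; rewrite /v /= => e.
have e1 : b j = \sum_l endo_app ([ffun l => (l == j)%:R] l : endo (X i)) (b l).
  rewrite (bigD1 j) //= ffunE eqxx big1 ?addr0; first by rewrite /endo_app lfunE.
  by move=> l /negPf nl; rewrite ffunE nl /endo_app lfunE.
rewrite {1}e1 in e; have /ffunP/(_ j) := b_free e.
by rewrite c0 ffunE eqxx => /eqP; rewrite oner_eq0.
Qed.

(** It suffices to find y0 that kills the other vectors but not v_t, for simplicity then carries v_t
    y0 to any target. *)
Lemma density_subset (S : {set T}) (s : T) : s \in S ->
  forall w : X (tag s), exists y, interpolates S w y.
Proof.
have [m] := ubnP #|S|; elim: m S s => // m IH S t; rewrite ltnS => leSm St.
pose S' := S :\ t.
have IH' s : s \in S' -> forall w : X (tag s), exists y, interpolates S' w y.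
  by apply: IH; apply: leq_trans leSm; rewrite [X in (_ < X)%N](cardsD1 t) St.
have [y0 [y0S y0t]] : exists y, (forall s, s \in S' -> ract (v s) y = 0) /\
    ract (v t) y != 0.
  (* Without such a y0, [density_hom] provides homomorphisms that express v_t through the other
     vectors, against freeness. *)
  apply: NNPP => no.
  have kill y : (forall s, s \in S' -> ract (v s) y = 0) -> ract (v t) y = 0.
    by move=> yS; apply/eqP; apply: contraT => nz; case: no; exists y.
  have homs s (Ss : s \in S') := density_hom Ss (IH' s Ss) kill.
  pose y (s : T) : A :=
    if boolP (s \in S') is AltTrue Ss then xchoose (IH' s Ss (v s)) else 0.
  have yP s : s \in S' -> interpolates S' (v s) (y s).
    move=> Ss; rewrite /y; case: {-}_ / boolP => [h|]; last by rewrite Ss.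
    exact: (xchooseP (IH' s h (v s))).
  apply: (@not_spanned t).
  (* The element 1 - \sum_s y_s kills every v_s with s in S', hence also v_t. *)
  have -> : v t = \sum_(s in S') ract (v t) (y s).
    rewrite -(linear_sum (ract (v t))) /=; apply/eqP.
    rewrite -[v t in X in X == _]ract1 -subr_eq0 -(linearB (ract (v t))) /=.
    apply/eqP/kill => s Ss; rewrite linearB /= ract1 linear_sum /= (bigD1 s) //=.
    have /interpolatesP[-> _] := yP s Ss.
    rewrite big1 ?addr0 ?subrr // => s' /andP[Ss' ne].
    have /interpolatesP[_ z] := yP s' Ss'.
    by apply: z; rewrite // eq_sym.
  elim/big_ind: _.
  - exists 0; rewrite ?ffunE // big1 // => l _.
    by rewrite /endo_app ffunE lfunE.
  - move=> u1 u2 [c1 z1 ->] [c2 z2 ->]; exists (c1 + c2).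
      by rewrite ffunE z1 z2 addr0.
    rewrite -big_split; apply: eq_bigr => l _.
    by rewrite /endo_app ffunE add_lfunE.
  move=> s Ss; have [f [fA fv]] := homs s Ss.
  rewrite -(fv _ _ (yP s Ss)); apply: spanned_hom => //.
  by case/setD1P: Ss.
move=> w; have [y1 ey1] := simple_cyclic w y0t.
exists (y0 * y1); apply/interpolatesP; rewrite ractM ey1; split=> // s' Ss' ne.
by rewrite ractM y0S ?ract0l // in_setD1 ne.
Qed.

Lemma density (w : forall i, 'I_(x i) -> X i) :
  exists y, forall i (j : 'I_(x i)), ract (b j) y = w i j.
Proof.
pose y (t : T) : A := xchoose (density_subset (in_setT t) (w (tag t) (tagged t))).
have yP t : @interpolates setT t (w (tag t) (tagged t)) (y t).
  exact: (xchooseP (density_subset (in_setT t) (w (tag t) (tagged t)))).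
exists (\sum_t y t) => i j; pose t0 : T := Tagged (fun i => 'I_(x i)) j.
rewrite -[b j]/(v t0) -[w i j]/(w (tag t0) (tagged t0)) linear_sum (bigD1 t0) //=.
have /interpolatesP[-> _] := yP t0; rewrite big1 ?addr0 // => t ne.
have /interpolatesP[_ z] := yP t.
by apply: (z t0); rewrite ?in_setT // eq_sym.
Qed.

End Density.
End Modules.

(** * Minimal right ideals as simple modules *)

Section RightIdeals.
Variables (K : fieldType) (A : falgType K).

Definition right_ideal (S : {vspace A}) := forall f g, f \in S -> f * g \in S.

Lemma minimal_right_ideal (S : {vspace A}) : right_ideal S -> S <> 0%VS ->
  exists S', [/\ (S' <= S)%VS, right_ideal S', S' <> 0%VS &
    forall U, right_ideal U -> (U <= S')%VS -> U = 0%VS \/ U = S'].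
Proof.
have [m] := ubnP (\dim S); elim: m S => // m IH S; rewrite ltnS => leSm idS nzS.
have [[U [idU sUS nzU neU]]|no] := classic (exists U,
    [/\ right_ideal U, (U <= S)%VS, U <> 0%VS & U <> S]).
  have [|S' [sS' idS' nz' min']] := IH U _ idU nzU; last first.
    by exists S'; split=> //; apply: subv_trans sUS.
  apply: leq_trans leSm; rewrite ltn_neqAle dimvS // andbT.
  by apply/negP => /eqP e; case: neU; apply/eqP; rewrite eqEdim sUS e /=.
exists S; split=> // U idU sUS; have [U0|nU0] := classic (U = 0%VS); first by left.
by right; apply: NNPP => neU; case: no; exists U.
Qed.

Section IdealModule.
Variables (S : {vspace A}) (idS : right_ideal S).

Definition ideal_act (u : subvs_of S) (x : A) : subvs_of S :=
  Subvs (idS x (subvsP u)).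

Lemma ideal_actDl u w x : ideal_act (u + w) x = ideal_act u x + ideal_act w x.
Proof. by apply/val_inj; rewrite /= mulrDl. Qed.
Lemma ideal_actDr u x y : ideal_act u (x + y) = ideal_act u x + ideal_act u y.
Proof. by apply/val_inj; rewrite /= mulrDr. Qed.
Lemma ideal_act1 u : ideal_act u 1 = u.
Proof. by apply/val_inj; rewrite /= mulr1. Qed.
Lemma ideal_actM u x y : ideal_act u (x * y) = ideal_act (ideal_act u x) y.
Proof. by apply/val_inj; rewrite /= mulrA. Qed.
Lemma ideal_act_scalar u (q : K) : ideal_act u q%:A = q *: u.
Proof. by apply/val_inj; rewrite /= mulr_algr. Qed.

Definition ideal_module : rmodule A :=
  RModule ideal_actDl ideal_actDr ideal_act1 ideal_actM ideal_act_scalar.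

Lemma ideal_module_simple : S <> 0%VS ->
    (forall U, right_ideal U -> (U <= S)%VS -> U = 0%VS \/ U = S) ->
  simple_module ideal_module.
Proof.
move=> nzS minS; split=> [e|U idU].
  case: nzS; apply/eqP; rewrite -subv0; apply/subvP => f Sf.
  have := memvf (Subvs Sf : ideal_module); rewrite e memv0 => /eqP/(congr1 vsval) /= ->.
  exact: mem0v.
pose U' := (linfun (vsval : ideal_module -> A) @: U)%VS.
have U'P f : reflect (exists2 u : ideal_module, u \in U & f = vsval u) (f \in U').
  by apply: (iffP memv_imgP) => -[u Uu ->]; exists u; rewrite ?lfunE.
have [] := minS U'.
- move=> f g /U'P[u Uu ->]; apply/U'P; exists (ract u g) => //; exact: idU.
- by apply/subvP => f /U'P[u _ ->]; apply: subvsP.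
- move=> e; left; apply/eqP; rewrite -subv0; apply/subvP => u Uu.
  have : vsval u \in U' by apply/U'P; exists u.
  by rewrite e !memv0.
move=> e; right; apply/eqP; rewrite eqEsubv subvf; apply/subvP => u _.
have : vsval u \in U' by rewrite e subvsP.
by case/U'P => u' Uu' /val_inj->.
Qed.

End IdealModule.
End RightIdeals.

(** * Maschke's theorem for the twisted group ring *)

Section Semisimplicity.
Variables (K : fieldType) (L : fieldExtType K) (gT : finGroupType).
Variable a : field_action L gT.
Local Notation A := (twisted_ring a).
Local Notation N := (act_kernel a).
Hypothesis n_unit : (#|N|%:R : K) \is a GRing.unit.

Lemma tw1M (y z : L) : tw a 1%g (y * z) = tw a 1%g y * tw a 1%g z.
Proof. by rewrite tw_mulE mulg1 factg1. Qed.

Fact tw_is_linear s : linear (tw a s).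
Proof.
move=> k y z; apply/ffunP => r; rewrite !ffunE.
by case: eqP; rewrite ?scaler0 ?addr0.
Qed.
HB.instance Definition _ s := GRing.isSemilinear.Build K L A _ (tw a s)
  (GRing.semilinear_linear (tw_is_linear s)).

Lemma global_trace_surj (e : L) : e \in 1%VS -> exists y, \sum_s a y s = e.
Proof.
move=> /(fact_fixed a) fe.
have [|y ey] := @cent_trace_surj _ _ _ a 1%g n_unit e; first exact/cent_fixedP.
by exists y; rewrite -ey; apply: eq_bigl => s; rewrite /= cent11T inE.
Qed.

(** A right L-linear projection p onto S is averaged over G to a right A-linear projection q; then e
    = q(1), since q(1) f = q(f) = f on S. *)
Lemma maschke (S : {vspace A}) : right_ideal S ->
  exists2 e, e \in S & forall f, f \in S -> e * f = f.
Proof.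
move=> idS; have [y ey] := global_trace_surj (mem1v 1%AS).
pose s (z : L) : 'End(A) := amulr (tw a 1%g z).
have s_linear : linear s by move=> k z1 z2; rewrite /s !linearP.
have sM z1 z2 (f : A) : s (z1 * z2) f = s z1 (s z2 f).
  by rewrite !lfunE /= mulrC tw1M mulrA.
have s1 (f : A) : s 1 f = f by rewrite lfunE /= mulr1.
have stA : unital_stable s {:A} by move=> f _; split=> // z; rewrite memvf.
have stS : unital_stable s S by move=> f Sf; split=> // z; rewrite lfunE /= idS.
have [S1 [st1 cap1 sum1]] := unital_stable_complement s_linear sM stA stS (subvf S).
pose p := daddv_pi S S1.
have pS f : p f \in S by apply: memv_pi.
have pid f : f \in S -> p f = f by apply: daddv_pi_id.
have pz f z : p (f * tw a 1%g z) = p f * tw a 1%g z.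
  have : f \in (S + S1)%VS by rewrite sum1 memvf.
  case/memv_addP => f0 Sf0 [f1 Sf1 ->].
  have p1 g : g \in S1 -> p g = 0.
    move=> Sg; apply: (addIr (daddv_pi S1 S g)).
    rewrite daddv_pi_add // ?sum1 ?memvf // add0r daddv_pi_id //.
    by rewrite capvC.
  rewrite mulrDl !linearD /= mulrDl; congr (_ + _); first by rewrite !pid ?idS.
  by rewrite (p1 f1) // mul0r p1 //; have [_ /(_ z)] := st1 _ Sf1; rewrite lfunE.
(* Weighting the average of the conjugates of p by an element y of trace 1   *)
(* makes q the identity on S without dividing by the order of the group.     *)
pose q f := \sum_t p (f * tw a t^-1%g 1) * tw a t (a y t).
have qS f : q f \in S by apply: memv_suml => t _; apply: idS.
exists (q 1) => // f Sf.
have qD f1 f2 : q (f1 + f2) = q f1 + q f2.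
  by rewrite /q -big_split; apply: eq_bigr => t _; rewrite mulrDl linearD mulrDl.
have q0 : q 0 = 0.
  by rewrite /q big1 // => t _; rewrite mul0r linear0 mul0r.
(* Linearity of q is tested on the elements t z, with the summation index shifted by t^-1. *)
have -> : q 1 * f = q f.
  rewrite [f in RHS]tw_sum [f in LHS]tw_sum (big_morph q qD q0) mulr_sumr.
  apply: eq_bigr => t _; move: (f t) => z.
  rewrite /q mulr_suml (reindex_inj (mulIg t^-1%g)) /=; apply: eq_bigr => r _.
  rewrite mul1r -mulrA !tw_mulE invMg invgK mulgKV mulr1.
  have -> : tw a (t * r^-1)%g (a z r^-1%g) = tw a (t * r^-1)%g 1 * tw a 1%g (a z r^-1%g).
    by rewrite tw_mulE mulg1 fact1 mul1r.
  rewrite pz -[RHS]mulrA tw_mulE mul1g -!factgM mulVg mulgKV factg1.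
  by rewrite mulrC.
transitivity (\sum_t f * tw a 1%g (a y t)).
  apply: eq_bigr => t _; rewrite pid ?idS // -mulrA tw_mulE mulVg fact1 mul1r //.
by rewrite -mulr_sumr -linear_sum ey mulr1.
Qed.

(** Otherwise the common annihilator contains a minimal right ideal S, which is isomorphic to some
    X_i and so killed by its own left identity e; then e = e e = 0, although S is nonzero. *)
Lemma simple_modules_faithful (k : nat) (X : 'I_k -> simple_rmodule A)
    (X_complete : forall Y : simple_rmodule A, exists i, module_iso Y (X i)) (f : A) :
  (forall i (u : X i), ract u f = 0) -> f = 0.
Proof.
move=> f0; pose I := (\bigcap_i lker (linfun (ractop (X i))))%VS.
have IP g : reflect (forall i (u : X i), ract u g = 0) (g \in I).
  apply: (iffP subv_bigcapP) => [Ig i u | Ig i _].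
    have := Ig i isT; rewrite -memvE memv_ker lfunE /= => /eqP e.
    by rewrite -ractopE e lfunE.
  rewrite -memvE memv_ker lfunE; apply/eqP/lfunP => u /=.
  by rewrite ractopE Ig lfunE.
have idI : right_ideal I.
  by move=> g h /IP Ig; apply/IP => i u; rewrite ractM Ig ract0l.
have [I0|nzI] := classic (I = 0%VS).
  by apply/eqP; rewrite -memv0 -I0; apply/IP.
have [S [sSI idS nzS minS]] := minimal_right_ideal idI nzI.
pose Y := SimpleRModule (ideal_module_simple idS nzS minS).
have [i [h [[h' hK _] hA]]] := X_complete Y.
have [e Se eS] := maschke idS.
have ee : e * e = 0.
  have /(congr1 h') : h (ract (Subvs Se : Y) e) = h 0.
    by rewrite hA linear0; apply: (IP _ (subvP sSI _ Se)).
  by rewrite !hK => /(congr1 vsval).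
apply: (False_ind _ (nzS _)); apply/eqP; rewrite -subv0; apply/subvP => g Sg.
by rewrite -(eS g Sg) -(eS e Se) ee mul0r mem0v.
Qed.

End Semisimplicity.

(** * The simple components *)

Section CentreField.
Variables (K : fieldType) (A : falgType K) (X : simple_rmodule A).

(** A separate name on which the field structure is declared. *)
Definition centre_field : predArgType := central (endo X).
HB.instance Definition _ := Falgebra.on centre_field.
Implicit Types f g : centre_field.

Lemma centre_fieldE f g :
  f = g <-> forall u : X, endo_app (vsval f) u = endo_app (vsval g) u.
Proof.
by split=> [->//|e]; apply/val_inj/val_inj/lfunP => u; apply: e.
Qed.

Lemma centre_fieldC f (g : endo X) u :
  endo_app (vsval f) (endo_app g u) = endo_app g (endo_app (vsval f) u).
Proof.
by have /memv_capP[_ /centvP fC] := subvsP f; rewrite -!endo_mulE fC ?memvf.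
Qed.

Lemma centre_field_mulE f g u :
  endo_app (vsval (f * g)) u = endo_app (vsval f) (endo_app (vsval g) u).
Proof. exact: endo_mulE. Qed.

Lemma centre_field1E (u : X) : endo_app (vsval (1 : centre_field)) u = u.
Proof.
have -> : vsval (1 : centre_field) = 1.
  apply/eqP; rewrite [_ == _]algid_eq1 memv_cap memvf; apply/centvP => g _.
  by rewrite mul1r mulr1.
by rewrite /endo_app lfunE.
Qed.

Lemma centre_field_mulC : commutative (@GRing.mul centre_field).
Proof.
move=> f g; apply/centre_fieldE => u.
by rewrite !centre_field_mulE centre_fieldC.
Qed.
HB.instance Definition _ :=
  GRing.PzRing_hasCommutativeMul.Build centre_field centre_field_mulC.

Lemma endo_app_inj (g : endo X) (u : X) : g != 0 -> endo_app g u = 0 -> u = 0.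
Proof.
move=> nzg gu; have [_ /(_ (lker (vsval g)))] := srmod_simple X; case.
- move=> w x; rewrite !memv_ker -!/(endo_app _ _) endo_appA => /eqP->.
  by rewrite ract0l.
- by move=> e; apply/eqP; rewrite -memv0 -e memv_ker -/(endo_app _ _) gu.
move=> e; case/eqP: nzg; apply/val_inj/lfunP => w; rewrite lfunE.
by apply/eqP; rewrite -memv_ker e memvf.
Qed.

(** By Schur, multiplication by a nonzero f is injective, hence onto in finite dimension. *)
Lemma centre_field_axiom : GRing.field_axiom centre_field.
Proof.
move=> f nzf; apply/unitrP.
have nzf' : vsval f != 0.
  by apply: contra_neq nzf => e; apply: val_inj.
pose m : 'End(centre_field) := amulr f.
have ker0 : (lker m = 0)%VS.
  apply/eqP.
  rewrite -subv0; apply/subvP => g; rewrite memv_ker memv0 lfunE /= => /eqP gf.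
  apply/eqP/centre_fieldE => u; rewrite [RHS]lfunE.
  apply: (endo_app_inj nzf'); rewrite -endo_mulE.
  rewrite -[vsval f * vsval g]/(vsval (f * g)) centre_field_mulC.
  by rewrite gf /endo_app lfunE.
have /memv_imgP[g _ eg] : 1 \in limg m.
  have -> : limg m = fullv.
    have dimE : \dim (limg m) = \dim {:centre_field}.
      by apply: limg_dim_eq; rewrite ker0 capv0.
    by apply/eqP; rewrite eqEdim subvf dimE leqnn.
  exact: memvf.
exists g; have e1 : g * f = 1 by rewrite eg lfunE.
by rewrite e1 centre_field_mulC e1.
Qed.
HB.instance Definition _ := GRing.ComUnitRing_isField.Build centre_field
  centre_field_axiom.
End CentreField.

Lemma has_ldim_dim (K : fieldType) (D : falgType K) (V : vectType K)
    (s : D -> V -> V) (m : nat) : (forall v, linear (s^~ v)) ->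
  has_ldim s m -> \dim {:V} = (m * \dim {:D})%N.
Proof.
move=> lin [b bij_b]; pose h (c : {ffun 'I_m -> D}) := \sum_j s (c j) (b j).
have hL : linear h.
  move=> k c c'; rewrite /h scaler_sumr -big_split; apply: eq_bigr => j _ /=.
  by rewrite !ffunE lin.
pose H := GRing.isSemilinear.Build K {ffun 'I_m -> D} V _ h
  (GRing.semilinear_linear hL).
pose hl : {linear {ffun 'I_m -> D} -> V} := HB.pack h H.
by rewrite -[m in RHS]card_ord; apply: (@dim_bij_ffun _ _ _ _ hl).
Qed.

(** * Central idempotents e_i and the spaces e_i L[N] *)

Section Components.
Variables (K : fieldType) (L : fieldExtType K) (gT : finGroupType).
Variable a : field_action L gT.
Local Notation A := (twisted_ring a).
Local Notation N := (act_kernel a).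
Hypothesis n_unit : (#|N|%:R : K) \is a GRing.unit.
Variables (k : nat) (X : 'I_k -> simple_rmodule A) (x : 'I_k -> nat).
Hypothesis X_distinct : forall i j, module_iso (X i) (X j) -> i = j.
Hypothesis X_complete : forall Y : simple_rmodule A, exists i, module_iso Y (X i).
Variable b : forall i, 'I_(x i) -> X i.
Hypothesis b_free : forall i, injective (fun c : {ffun 'I_(x i) -> endo (X i)} =>
  \sum_j endo_app (c j) (b j)).
Hypothesis b_span : forall i (u : X i),
  exists c : {ffun 'I_(x i) -> endo (X i)}, u = \sum_j endo_app (c j) (b j).

Local Notation F i := (centre_field (X i)).
Implicit Types f g : A.

Lemma ract_eq f g : (forall i (u : X i), ract u f = ract u g) -> f = g.
Proof.
move=> e; apply/eqP; rewrite -subr_eq0; apply/eqP.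
apply: (simple_modules_faithful n_unit X_complete) => i u.
by rewrite (linearB (ract u)) /= e subrr.
Qed.

Definition acts_as (fs : forall i, F i) f :=
  forall i (u : X i), ract u f = endo_app (vsval (fs i)) u.

(** Density prescribes the action on the bases; it extends to all of X_i because elements of F_i
    commute with the coefficients in K_i. *)
Lemma acts_as_ex (fs : forall i, F i) :
  exists f, [forall i, ractop (X i) f == vsval (vsval (fs i))].
Proof.
have [f ef] := density X_distinct b_free
  (fun i (j : 'I_(x i)) => endo_app (vsval (fs i)) (b j)).
exists f; apply/forallP => i; apply/eqP/lfunP => u; rewrite ractopE.
rewrite -/(endo_app (vsval (fs i)) u).
have [c ->] := b_span u; rewrite ract_suml.
have -> : endo_app (vsval (fs i)) (\sum_j endo_app (c j) (b j)) =
    \sum_j endo_app (vsval (fs i)) (endo_app (c j) (b j)).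
  by rewrite [LHS]/endo_app linear_sum.
by apply: eq_bigr => j _; rewrite centre_fieldC -ef endo_appA.
Qed.

Lemma acts_as_sig (fs : forall i, F i) : {f : A | acts_as fs f}.
Proof.
exists (xchoose (acts_as_ex fs)) => i u.
by have /forallP/(_ i)/eqP e := xchooseP (acts_as_ex fs); rewrite -ractopE e.
Qed.

Definition lift (fs : forall i, F i) : A := sval (acts_as_sig fs).

Lemma liftP (fs : forall i, F i) : acts_as fs (lift fs).
Proof. exact: svalP. Qed.

Lemma lift_central fs g : lift fs * g = g * lift fs.
Proof.
by apply: ract_eq => i u; rewrite !ractM !liftP endo_appA.
Qed.

Lemma lift_in_centre fs : lift fs \in 'Z({:A})%AS.
Proof.
by rewrite memv_cap memvf; apply/centvP => g _; rewrite lift_central.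
Qed.

(** This embeds F_i into the centre of A; [component 1] is the central idempotent e_i. *)
Definition component i (f : F i) : A := lift (dfwith (fun j => 0 : F j) f).

Lemma component_same i (f : F i) (u : X i) :
  ract u (component f) = endo_app (vsval f) u.
Proof. by rewrite liftP dfwith_in. Qed.

Lemma component_other i (f : F i) j (u : X j) : j != i ->
  ract u (component f) = 0.
Proof.
by move=> ne; rewrite liftP dfwith_out 1?eq_sym // /endo_app lfunE.
Qed.

Lemma component_linear i : linear (@component i).
Proof.
move=> q f g; apply: ract_eq => j u; rewrite [RHS](linearP (ract u)) /=.
have [e|ne] := eqVneq j i; last first.
  apply: etrans (component_other _ _ ne) _.
  by rewrite (component_other f) // (component_other g) // scaler0 addr0.
subst j; apply: etrans (component_same _ _) _.
rewrite (component_same f) (component_same g).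
by rewrite /endo_app linearP add_lfunE scale_lfunE.
Qed.

HB.instance Definition _ i := GRing.isSemilinear.Build K (F i) A _
  (@component i) (GRing.semilinear_linear (@component_linear i)).

Lemma componentM i (f g : F i) : component (f * g) = component f * component g.
Proof.
apply: ract_eq => j u; rewrite [RHS]ractM.
have [e|ne] := eqVneq j i; last first.
  apply: etrans (component_other _ _ ne) _; apply/esym.
  exact: component_other.
subst j; apply: etrans (component_same _ _) _.
rewrite (component_same f) (component_same g).
by rewrite centre_field_mulE centre_fieldC.
Qed.

Lemma sum_component : \sum_i component (1 : F i) = 1.
Proof.
apply: ract_eq => i u; rewrite (linear_sum (ract u)) /= ract1.
rewrite (bigD1 i isT); have -> := component_same (1 : F i) u.
rewrite centre_field1E big1 => [|j ne]; first exact: addr0.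
by rewrite (component_other (1 : F j)) // eq_sym.
Qed.

Lemma component_omega i (z : central A) :
  vsval z * component (1 : F i) = component (omega (X i) z : F i).
Proof.
apply: ract_eq => j u; rewrite ractM; have [e|ne] := eqVneq j i.
  subst j; rewrite (component_same (1 : F i)) centre_field1E.
  by rewrite (component_same (omega (X i) z : F i)) omegaE.
rewrite (component_other (1 : F i)) //.
by rewrite (component_other (omega (X i) z : F i)).
Qed.

Lemma component_comm i (f : F i) g : component f * g = g * component f.
Proof. exact: lift_central. Qed.

Definition restrict_kernel f : A := [ffun s => if s \in N then f s else 0].

Fact restrict_kernel_is_linear : linear restrict_kernel.
Proof.
move=> q f g; apply/ffunP => s; rewrite !ffunE.
by case: ifP; rewrite // scaler0 addr0.
Qed.
HB.instance Definition _ := GRing.isSemilinear.Build K A A _ restrict_kernel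
  (GRing.semilinear_linear restrict_kernel_is_linear).

(** Left multiplication by an element of L[N] respects the cosets of N. *)
Lemma restrict_kernelM f g : restrict_kernel f = f ->
  restrict_kernel (f * g) = f * restrict_kernel g.
Proof.
move=> ef; have f0 r : r \notin N -> f r = 0.
  by move=> /negPf nr; rewrite -ef ffunE nr.
pose NG := act_kernel_group a.
apply/ffunP => s; rewrite ffunE [RHS]ffunE; case: ifPn => Ns.
  rewrite ffunE; apply: eq_bigr => t _; rewrite ffunE; case: ifPn => // Nt.
  rewrite f0 ?Defs.fact0 ?mul0r // -[N]/(NG : {set gT}).
  by rewrite (groupMl _ (Ns : s \in NG)) groupV.
rewrite big1 // => t _; rewrite ffunE; case: ifPn => Nt; last by rewrite mulr0.
rewrite f0 ?Defs.fact0 ?mul0r // -[N]/(NG : {set gT}).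
by rewrite groupMr ?groupV.
Qed.

Lemma restrict_kernel_tw s y :
  restrict_kernel (tw a s y) = if s \in N then tw a s y else 0.
Proof.
apply/ffunP => r; rewrite ffunE; have [->|ne] := eqVneq r s.
  by case: ifP; rewrite !ffunE.
have e0 : tw a s y r = 0 by rewrite ffunE (negPf ne).
by case: ifP => _; case: ifP => _; rewrite ?e0 ?ffunE.
Qed.

Lemma restrict_kernel_central f : f \in 'Z({:A})%AS -> restrict_kernel f = f.
Proof.
move=> fZ; apply/ffunP => s; rewrite ffunE; case: ifPn => // ns.
by rewrite central_support.
Qed.

Lemma restrict_kernel_id f : restrict_kernel (restrict_kernel f) = restrict_kernel f.
Proof. by apply/ffunP => s; rewrite !ffunE; case: (s \in N). Qed.

Lemma restrict_kernel_conj f t :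
  restrict_kernel (tw a t^-1%g 1 * f * tw a t 1) =
  tw a t^-1%g 1 * restrict_kernel f * tw a t 1.
Proof.
apply/ffunP => s; rewrite ffunE !tw_mulr_coef !tw_mull_coef ffunE invgK.
have -> : (s \in N) = ((t * (s * t^-1))%g \in N).
  by rewrite -(act_kernelJ a s t^-1%g) conjgE invgK.
by case: ifP => // _; rewrite mulr0 Defs.fact0 mul0r.
Qed.

Section OneComponent.
Variable i : 'I_k.
Implicit Types (u v : A).
Local Notation e := (component (1 : F i)).

Lemma component1K (f : F i) : e * component f = component f.
Proof. by rewrite -componentM mul1r. Qed.

Definition component_scalar (f : F i) : 'End(A) := amull (component f).

Lemma component_scalarE (f : F i) v : component_scalar f v = component f * v.
Proof. by rewrite lfunE. Qed.

Lemma component_scalar_linear : linear component_scalar.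
Proof.
move=> q f g; apply/lfunP => h.
rewrite add_lfunE scale_lfunE !component_scalarE component_linear.
by rewrite mulrDl scalerAl.
Qed.

Lemma component_scalarM (f g : F i) v :
  component_scalar (f * g) v = component_scalar f (component_scalar g v).
Proof. by rewrite !component_scalarE componentM mulrA. Qed.

(** This is U_i = e_i L[N]; as e_i lies in L[N], it consists of the elements of L[N] fixed by
    e_i. *)
Definition kernel_component : {vspace A} :=
  limg (component_scalar 1 \o linfun restrict_kernel)%VF.

Lemma kernel_componentP v :
  reflect (e * v = v /\ restrict_kernel v = v) (v \in kernel_component).
Proof.
apply: (iffP memv_imgP) => [[g _ ->]|[ef rf]].
  rewrite comp_lfunE component_scalarE lfunE /= mulrA component1K; split=> //.
  rewrite restrict_kernelM ?restrict_kernel_id //.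
  by rewrite restrict_kernel_central ?lift_in_centre.
by exists v; rewrite ?memvf // comp_lfunE component_scalarE lfunE /= rf.
Qed.

Lemma restrict_component (f : F i) v :
  restrict_kernel (component f * v) = component f * restrict_kernel v.
Proof.
by apply: restrict_kernelM; rewrite restrict_kernel_central ?lift_in_centre.
Qed.

Lemma kernel_component_unital : unital_stable component_scalar kernel_component.
Proof.
move=> u /kernel_componentP[eu ru].
split=> [|f]; rewrite component_scalarE //.
apply/kernel_componentP; rewrite mulrA component1K; split=> //.
by rewrite restrict_component ru.
Qed.

Let lmul (y : L) : 'End(A) := amull (tw a 1%g y).
Let twist (t : gT) : 'End(A) := (amulr (tw a t 1) \o amull (tw a t^-1%g 1))%VF.

Let lmulE y u : lmul y u = tw a 1%g y * u. Proof. by rewrite lfunE. Qed.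
Let twistE t u : twist t u = tw a t^-1%g 1 * u * tw a t 1.
Proof. by rewrite comp_lfunE !lfunE. Qed.

Lemma act_kernel1 : 1%g \in N. Proof. exact: (group1 (act_kernel_group a)). Qed.

Lemma lmul_scalar_operator y : scalar_operator component_scalar kernel_component (lmul y).
Proof.
move=> u /kernel_componentP[eu ru]; split=> [|f].
  apply/kernel_componentP; rewrite lmulE mulrA component_comm -mulrA eu; split=> //.
  by rewrite restrict_kernelM ?ru // restrict_kernel_tw act_kernel1.
by rewrite !component_scalarE !lmulE mulrA -component_comm mulrA.
Qed.

Lemma twist_scalar_operator t :
  scalar_operator component_scalar kernel_component (twist t).
Proof.
move=> u /kernel_componentP[eu ru]; split=> [|f].
  apply/kernel_componentP; rewrite twistE restrict_kernel_conj ru; split=> //.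
  by rewrite !mulrA component_comm -[_ * e * u]mulrA eu.
by rewrite !component_scalarE !twistE !mulrA -component_comm.
Qed.

Lemma twistK t u : twist t^-1%g (twist t u) = u.
Proof.
rewrite !twistE !mulrA invgK tw_mulE mulgV fact1 mulr1 mul1r -mulrA tw_mulE.
by rewrite mulgV fact1 mulr1 mulr1.
Qed.

Lemma twist_lmul t y u : twist t (lmul y u) = lmul (a y t) (twist t u).
Proof.
rewrite !twistE !lmulE !mulrA !tw_mulE mulg1 mul1g mulr1 fact1 mul1r.
by rewrite -!factgM mulgV factg1.
Qed.

(** The semilinear results are applied at v = 1 and K' = K: L acts on U_i by left multiplication,
    and conjugation by t is F_i-linear and carries y to y^t. *)
Lemma kernel_component_trace : exists c : nat,
  [/\ \dim kernel_component = (c * \dim {:F i})%N, (\dim {:L} %| c)%N &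
    forall y (g : F i), \sum_s a y s = (#|N|%:R)%:A ->
      lftrace (component_scalar g \o lmul y
                 \o (component_scalar 1 \o linfun restrict_kernel))%VF =
      falg_trace (g * (c %/ \dim {:L})%:R)].
Proof.
have stU := kernel_component_unital.
have [c [w [p [wU eU pw ps]]]] :=
  scalars_basis component_scalar_linear component_scalarM stU.
have lmulD y1 y2 : lmul (y1 + y2) = lmul y1 + lmul y2.
  by apply/lfunP => u; rewrite add_lfunE !lmulE linearD mulrDl.
have lmulM y1 y2 : lmul (y1 * y2) = (lmul y2 \o lmul y1)%VF.
  by apply/lfunP => u; rewrite comp_lfunE !lmulE mulrC tw1M mulrA.
have lmul1 u : u \in kernel_component -> lmul 1 u = u by rewrite lmulE mul1r.
have kap (m : {poly L}) : m \is a polyOver (cent_fixed_aspace a 1%g) ->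
    exists q : {poly K}, m = map_poly (in_alg L) q.
  rewrite -[pred_of_vspace _]/(pred_of_vspace (cent_fixed a 1%g)) cent_fixed1.
  by move/polyOver1P.
have lmulk (q : K) u : u \in kernel_component ->
    lmul (in_alg L q) u = component_scalar (in_alg (F i) q) u.
  move=> /kernel_componentP[eu _].
  rewrite lmulE component_scalarE (linearZ_LR (tw a 1%g)) (linearZ_LR (@component i)).
  by rewrite -!scalerAl eu mul1r.
have Top t (_ : t \in 'C[1%g]%G) := twist_scalar_operator t.
exists c; split.
- by have -> := dim_scalars component_scalar_linear stU wU eU pw.
- rewrite (dim_galois a).
  exact: (semilinear_rank stU wU eU pw ps lmulD lmulM lmul1 lmul_scalar_operator Top
    (fun t u _ => twistK t u) (fun t y u _ => twist_lmul t y u) kap lmulk).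
move=> y g ey.
have := semilinear_trace stU wU eU pw ps lmulD lmulM lmul1 lmul_scalar_operator Top
    (fun t u _ => twistK t u) (fun t y u _ => twist_lmul t y u) kap lmulk.
move=> /(_ y #|N|%:R).
have -> : cent_trace a 1%g y = \sum_t a y t.
  by apply: eq_bigl => t; rewrite /= cent11T inE.
move=> /(_ ey); rewrite rmorph_nat /= -[gval 'C[1%g]%G]/('C[1%g]%g).
rewrite -dim_galois -[gval 'C_N[1%g]%G]/('C_N[1%g]%g) cent11T setIT.
have nF : (#|N|%:R : F i) != 0.
  by rewrite -(rmorph_nat (in_alg (F i))) fmorph_eq0 -unitfE.
(* As the conjugates of y add up to n, the factor n cancels and y has F_i-trace c/h on U_i. *)
rewrite [RHS]mulrC => /(mulfI nF) etr.
pose q := (component_scalar 1 \o linfun restrict_kernel)%VF.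
have qU u : q u \in kernel_component by apply: memv_img; rewrite memvf.
have qid u : u \in kernel_component -> q u = u.
  case/kernel_componentP => eu ru.
  by rewrite comp_lfunE component_scalarE lfunE /= ru.
have sumq : \sum_j (orbit_map component_scalar (w j) \o (p j \o q))%VF = q.
  apply/lfunP => u; rewrite sum_lfunE [RHS](eU _ (qU u)).
  apply: eq_bigr => j _; rewrite comp_lfunE (orbit_mapE component_scalar_linear).
  by rewrite comp_lfunE.
have := lftrace_scalar_operator component_scalar_linear component_scalarM stU wU ps
  g (lmul_scalar_operator y) qid.
by rewrite sumq etr.
Qed.

Local Notation EA := (limg (component_scalar 1)).

Lemma componentP u : reflect (e * u = u) (u \in EA).
Proof.
apply: (iffP memv_imgP) => [[v _ ->]|eu].
  by rewrite component_scalarE mulrA component1K.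
by exists u; rewrite ?memvf // component_scalarE.
Qed.

Lemma component_interpolation (c : {ffun 'I_(x i) -> X i}) :
  exists g, [forall j, ract (b j) g == c j].
Proof.
have [g eg] := density X_distinct b_free
  (fun l => dfwith (fun l => 0 : {ffun 'I_(x l) -> X l}) c l).
by exists g; apply/forallP => j; rewrite eg dfwith_in.
Qed.

(** The map f |-> (b_j f)_j from e_i A to X_i^(x_i) is onto by density, and injective because
    elements of A are determined by their action on the simple modules. *)
Lemma component_dim : \dim EA = (x i * \dim {:X i})%N.
Proof.
pose h (f : subvs_of EA) : {ffun 'I_(x i) -> X i} := [ffun j => ract (b j) (vsval f)].
have hL : linear h.
  by move=> q f g; apply/ffunP => j; rewrite !ffunE (linearP (ract (b j))).
pose H := GRing.isSemilinear.Build K (subvs_of EA) {ffun 'I_(x i) -> X i} _ h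
  (GRing.semilinear_linear hL).
pose hl : {linear subvs_of EA -> {ffun 'I_(x i) -> X i}} := HB.pack h H.
have ract1e (u : X i) : ract u e = u.
  by rewrite (component_same (1 : F i)) centre_field1E.
pose g c := e * xchoose (component_interpolation c).
have gE c : e * g c = g c by rewrite /g mulrA component1K.
have gb c j : ract (b j) (g c) = c j.
  rewrite ractM ract1e.
  by have /forallP/(_ j)/eqP := xchooseP (component_interpolation c).
have bij_h : bijective hl.
  exists (fun c => vsproj EA (g c)) => [f|c]; last first.
    by apply/ffunP => j; rewrite ffunE vsprojK ?gb //; apply/componentP.
  apply/val_inj; rewrite /= vsprojK; last exact/componentP.
  have /componentP ef := subvsP f.
  apply: ract_eq => l u; have [el|ne] := eqVneq l i; last first.
    have z v : e * v = v -> ract u v = 0.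
      by move=> <-; rewrite ractM (component_other (1 : F i)) // ract0l.
    by rewrite !z.
  subst l; have [c ->] := b_span u; rewrite !ract_suml; apply: eq_bigr => j _.
  by rewrite -!endo_appA gb ffunE.
rewrite -(dim_subvs EA) (dim_bij bij_h).
have := @dim_bij_ffun _ (X i) _ 'I_(x i) idfun; rewrite card_ord; apply.
by exists idfun.
Qed.

(** e_i A is the direct sum of the translates U_i r over coset representatives r of N in G, and
    [G : N] = h. *)
Lemma component_coset_dim : \dim EA = (\dim {:L} * \dim kernel_component)%N.
Proof.
pose NG := act_kernel_group a.
pose m := #|rcosets NG [set: gT]|; pose r (j : 'I_m) := repr (enum_val j).
have eR j : enum_val j = (NG :* r j)%g.
  have /rcosetsP[t _ et] := enum_valP j.
  by rewrite /r et rcoset_repr.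
have key t : exists j0, forall j, ((t * (r j)^-1)%g \in N) = (j == j0).
  have Rt : (NG :* t)%g \in rcosets NG [set: gT].
    by apply/rcosetsP; exists t; rewrite ?inE.
  exists (enum_rank_in Rt (NG :* t)%g) => j.
  rewrite -[N]/(NG : {set gT}) -mem_rcoset -eR -(inj_eq enum_val_inj).
  rewrite enum_rankK_in // eR; apply/idP/eqP => [/rcoset_eqP //|->].
  exact: rcoset_refl.
have keyr j l : ((r j * (r l)^-1)%g \in N) = (l == j).
  have [j0 ej0] := key (r j); rewrite ej0; congr (_ == _).
  by apply/esym/eqP; rewrite -ej0 mulgV act_kernel1.
pose S := subvs_of kernel_component.
pose h0 (c : {ffun 'I_m -> S}) : A := \sum_j vsval (c j) * tw a (r j) 1.
have h0E c : h0 c \in EA.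
  apply: memv_suml => j _; apply/componentP; rewrite mulrA.
  by case/kernel_componentP: (subvsP (c j)) => ->.
pose h c : subvs_of EA := vsproj EA (h0 c).
have hL : linear h.
  move=> q c d; rewrite -linearP /=; congr (vsproj EA _).
  rewrite /h0 scaler_sumr -big_split; apply: eq_bigr => j _ /=.
  by rewrite !ffunE linearP mulrDl scalerAl.
pose H := GRing.isSemilinear.Build K {ffun 'I_m -> S} (subvs_of EA) _ h
  (GRing.semilinear_linear hL).
pose hl : {linear {ffun 'I_m -> S} -> subvs_of EA} := HB.pack h H.
(* Shifting the coset N r_j back to N isolates the j-th summand. *)
pose g (f : A) j := restrict_kernel (f * tw a (r j)^-1%g 1).
have gU f j : f \in EA -> g f j \in kernel_component.
  move=> /componentP ef; apply/kernel_componentP.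
  by rewrite -restrict_component mulrA ef restrict_kernel_id.
have bij_h : bijective hl.
  exists (fun d : subvs_of EA => [ffun j => vsproj kernel_component (g (vsval d) j)])
      => [c|d].
    apply/ffunP => j; rewrite ffunE; apply/val_inj.
    rewrite /= !vsprojK ?gU // /g /h0 mulr_suml linear_sum (bigD1 j) //=.
    have rk l : restrict_kernel (vsval (c l) * tw a (r l) 1 * tw a (r j)^-1%g 1) =
        vsval (c l) *+ (j == l).
      rewrite -mulrA restrict_kernelM; last by case/kernel_componentP: (subvsP (c l)).
      rewrite tw_mulE fact1 mulr1 restrict_kernel_tw keyr.
      by case: eqP => [->|_]; rewrite ?mulgV ?mulr1 ?mulr0.
    rewrite rk eqxx big1 ?addr0 // => l; rewrite rk eq_sym => /negPf->.
    by rewrite mulr0n.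
  have Ef := subvsP d; apply/val_inj; rewrite /= vsprojK //.
  apply/ffunP => t; rewrite /h0 sum_ffunE; have [j0 ej0] := key t.
  have tE j : (vsval ([ffun l => vsproj kernel_component (g (vsval d) l)] j : S)
      * tw a (r j) 1) t = vsval d t *+ (j == j0).
    rewrite ffunE vsprojK ?gU // tw_mulr_coef mulr1 /g ffunE ej0.
    case: eqP => _; last exact: Defs.fact0.
    rewrite tw_mulr_coef invgK mulgKV mulr1 -factgM mulVg factg1.
    by rewrite mulr1n.
  rewrite (bigD1 j0) //= tE eqxx big1 ?addr0 // => j /negPf nj.
  by rewrite tE nj mulr0n.
have := dim_bij_ffun bij_h; rewrite !dim_subvs card_ord => ->.
by rewrite (dim_galois a) cent11T setIT.
Qed.

End OneComponent.
(** Only the blocks s L with s in N contribute, each the trace of multiplication by q y on L; and n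
    Tr_{L/K}(y) = n. *)
Lemma trace_kernel_restriction (z : A) y q : z 1%g = q%:A ->
    \sum_s a y s = (#|N|%:R)%:A ->
  lftrace (amull (tw a 1%g y * z) \o linfun restrict_kernel)%VF = #|N|%:R * q.
Proof.
move=> ez ey; set Theta := (_ \o _)%VF.
have ThetaE f : Theta f = tw a 1%g y * z * restrict_kernel f.
  by rewrite comp_lfunE !lfunE.
move: Theta ThetaE => Theta ThetaE; pose inj s : 'Hom(L, A) := linfun (tw a s).
have coef_linear s : linear (fun f : A => f s) by move=> c f g; rewrite !ffunE.
pose coef s : {linear A -> L} := HB.pack (fun f : A => f s)
  (GRing.isSemilinear.Build K A L _ (fun f : A => f s)
    (GRing.semilinear_linear (coef_linear s))).
pose proj s : 'Hom(A, L) := linfun (coef s).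
(* Inserting this identity and using cyclicity turns the trace on A into a sum of traces on L. *)
have sum_id : \sum_s (inj s \o proj s)%VF = \1%VF :> 'End(A).
  apply/lfunP => f; rewrite sum_lfunE lfunE /= {2}[f]tw_sum.
  by apply: eq_bigr => s _; rewrite comp_lfunE !lfunE.
rewrite -[Theta]comp_lfun1r -sum_id.
rewrite (big_morph (comp_lfun _) (comp_lfunDr _) (comp_lfun0r _ _)) linear_sum /=.
have tE s : lftrace (Theta \o (inj s \o proj s))%VF =
    if s \in N then q * falg_trace y else 0.
  rewrite comp_lfunA lftrace_comp.
  case: ifP => Ns; last first.
    rewrite (_ : (_ \o _)%VF = 0) ?linear0 //; apply/lfunP => c.
    rewrite !comp_lfunE !lfunE /= ThetaE restrict_kernel_tw Ns mulr0.
    by rewrite ffunE.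
  have -> : q * falg_trace y = lftrace (amulr (q *: y)) by rewrite -falg_traceE linearZ.
  congr lftrace; apply/lfunP => c.
  rewrite !comp_lfunE !lfunE /= ThetaE restrict_kernel_tw Ns.
  rewrite tw_mulr_coef mulgV (act_kernelP _ _ Ns) tw_mull_coef invg1 mulg1 factg1.
  by rewrite ez mulr_algr mulrC.
transitivity (\sum_(s in N) q * falg_trace y).
  by rewrite (eq_bigr _ (fun s _ => tE s)) -big_mkcond.
rewrite sumr_const.
have e : falg_trace y * #|N|%:R = #|N|%:R.
  by apply: (fmorph_inj (in_alg L)); rewrite mulrC /= galois_trace.
by rewrite -[LHS]mulr_natr -mulrA e mulrC.
Qed.

(** Insert 1 = \sum_i e_i; each e_i is central and idempotent, and z e_i is the image of omega_i(z)
    in A. *)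
Lemma trace_kernel_components (z : central A) y :
  lftrace (amull (tw a 1%g y * vsval z) \o linfun restrict_kernel)%VF =
  \sum_i lftrace (component_scalar (omega (X i) z : F i) \o amull (tw a 1%g y)
    \o (component_scalar (1 : F i) \o linfun restrict_kernel))%VF.
Proof.
rewrite -linear_sum; congr lftrace; apply/lfunP => f.
rewrite sum_lfunE comp_lfunE [LHS]lfunE /=.
rewrite -[LHS]mulr1 -sum_component mulr_sumr; apply: eq_bigr => i _.
rewrite !comp_lfunE !component_scalarE [amull _ _]lfunE /=.
rewrite -component_omega; move: (linfun restrict_kernel f) (tw a 1%g y) => w g.
have zC := centralP (subvsP z).
have -> : component (1 : F i) * w = w * component (1 : F i) by apply: component_comm.
rewrite -[RHS]mulrA; have -> : component (1 : F i) * (g * (w * component (1 : F i))) =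
    g * w * component (1 : F i).
  by rewrite component_comm -!mulrA component1K.
by rewrite -zC !mulrA.
Qed.

End Components.

Lemma omegaM (K : fieldType) (A : falgType K) (X : simple_rmodule A)
    (z z' : central A) :
  omega X (z * z') = omega X z * omega X z'.
Proof.
apply/val_inj/val_inj/lfunP => u; rewrite -[LHS]/(endo_app (vsval (omega X (z * z'))) u).
rewrite -[RHS]/(endo_app (vsval (omega X z) * vsval (omega X z')) u).
rewrite endo_mulE !omegaE -ractM; congr ract.
have /memv_capP[_ /centvP zC] := subvsP z.
by rewrite -[LHS]/(vsval z * vsval z') zC ?memvf.
Qed.

Theorem proposition1p40 (K : fieldType) (L : fieldExtType K)
    (gT : finGroupType) (a : field_action L gT)
    (n_unit : (#|act_kernel a|%:R : K) \is a GRing.unit)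
    (k : nat) (X : 'I_k -> simple_rmodule (twisted_ring a))
    (X_distinct : forall i j, module_iso (X i) (X j) -> i = j)
    (X_complete : forall Y : simple_rmodule (twisted_ring a),
       exists i, module_iso Y (X i))
    (x d : 'I_k -> nat)
    (x_dim : forall i, has_ldim (@endo_app K _ (X i)) (x i))
    (d_dim : forall i, (0 < d i)%N /\
       has_ldim (fun (z : central (endo (X i))) (f : endo (X i)) => vsval z * f)
         (d i ^ 2)%N)
    (B : {biscalar (central (twisted_ring a))}) (B_form : is_central_form B) :
  forall xi xi' : central (twisted_ring a),
    B xi xi' =
    \sum_(i < k) (#|act_kernel a|%:R)^-1
      * ((x i * d i) %/ \dim {:L})%N%:R ^+ 2
      * falg_trace (omega (X i) xi * omega (X i) xi').
Proof.
move=> xi xi'.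
have [b b_bij] := fin_all_exists x_dim.
have b_free i := bij_inj (b_bij i).
have b_span i (u : X i) : exists c : {ffun 'I_(x i) -> endo (X i)},
    u = \sum_j endo_app (c j) (b i j).
  by have [c _ cK] := b_bij i; exists (c u); rewrite cK.
have [y ey] : exists y, \sum_s a y s = (#|act_kernel a|%:R)%:A.
  by apply: (global_trace_surj n_unit); rewrite memvZ ?mem1v.
have ez := esym (central_form_coef n_unit B_form xi xi').
have := trace_kernel_restriction ez ey.
have -> := trace_kernel_components n_unit X_distinct X_complete b_free b_span
  (xi * xi') y.
move=> eB.
have nK : (#|act_kernel a|%:R : K) != 0 by rewrite -unitfE.
(* After multiplication by n both sides are sums over the simple modules, compared term by term. *)
apply: (mulfI nK); rewrite -eB mulr_sumr; apply: eq_bigr => i _.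
rewrite -[X in _ = _ * X]mulrA mulVKf //.
have [c [cU Lc trc]] := kernel_component_trace n_unit X_distinct X_complete
  b_free b_span i.
rewrite trc // omegaM.
have L_gt0 : (0 < \dim {:L})%N by rewrite adim_gt0.
have F_gt0 : (0 < \dim {:centre_field (X i)})%N by rewrite adim_gt0.
(* Both sides, times [F_i : K], are the K-dimension of e_i A. *)
have eq_c : (\dim {:L} * c = (x i * d i) ^ 2)%N.
  have dimX : \dim {:X i} = (x i * \dim {:endo (X i)})%N.
    apply: has_ldim_dim (x_dim i) => v q f g.
    by rewrite /endo_app linearP add_lfunE scale_lfunE.
  have dimD : \dim {:endo (X i)} = (d i ^ 2 * \dim {:centre_field (X i)})%N.
    have [_ Di] := d_dim i; apply: has_ldim_dim Di => v q f g.
    by rewrite linearP mulrDl scalerAl.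
  have := component_coset_dim n_unit X_distinct X_complete b_free b_span i.
  rewrite (component_dim n_unit X_distinct X_complete) cU dimX dimD => e.
  apply/eqP; rewrite -(eqn_pmul2r F_gt0) -mulnA -e.
  by rewrite expnMn !mulnA.
(* From h | c follows h^2 | h c = (x_i d_i)^2. *)
have dvd_xd : (\dim {:L} %| x i * d i)%N.
  rewrite -(@dvdn_pexp2r _ _ 2) // -eq_c expnS expn1.
  by apply: dvdn_mul.
have -> : (c %/ \dim {:L} = ((x i * d i) %/ \dim {:L}) ^ 2)%N.
  apply/eqP; rewrite -(eqn_pmul2r L_gt0) divnK // -(eqn_pmul2l L_gt0) eq_c.
  apply/eqP; rewrite -{1}(divnK dvd_xd) expnMn -(mulnn (\dim _)) mulnA.
  by rewrite [RHS]mulnC.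
by rewrite -natrX mulr_natr raddfMn mulr_natl.
Qed.
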